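(* Let $d\ge2$ be an integer, $a\in[0,1]$ and $\sigma\in\mathcal{D}(\mathbb{C}^d)$. Then the minimum output entropy of the channel $\mathcal{E}_{a,\sigma}$ satisfies $$H_{\min}(\mathcal{E}_{a,\sigma})\ \ge\ \min_{0\le H_0\le\log d} G(H_0)$$ for each of the following three functions $G:[0,\log d]\to\mathbb{R}$: (i) $G(H_0)=aH_0+(1-a)H(\sigma)$; (ii) $G(H_0)=\frac1c\log\big[a\,e^{cH_0}+(1-a)\,e^{cH(\sigma)}\big]$ with $c=1/(\log d)^2$; (iii) $G(H_0)=\frac1c\, g\big[a\,g^{-1}(cH_0)+(1-a)\,g^{-1}(cH(\sigma))\big]$ with $c=1/(d-1)$. In fact, for each of these functions $G$ and every $\rho\in\mathcal{D}(\mathbb{C}^d)$, $H(\mathcal{E}_{a,\sigma}(\rho))\ge G(H(\rho))$.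
   Context: $\mathcal{D}(\mathbb{C}^d)$ is the set of $d\times d$ complex positive semidefinite matrices of trace $1$. $\log$ is the natural logarithm, and $H(\rho):=-\operatorname{Tr}(\rho\log\rho)$ is the von Neumann entropy ($0\log0:=0$). The function $g:[0,\infty)\to[0,\infty)$, $g(x):=(x+1)\log(x+1)-x\log x$ (with $g(0)=0$), is a strictly increasing bijection with inverse $g^{-1}$. For fixed $a\in[0,1]$ and $\sigma\in\mathcal{D}(\mathbb{C}^d)$, the channel $\mathcal{E}_{a,\sigma}:\mathcal{D}(\mathbb{C}^d)\to\mathcal{D}(\mathbb{C}^d)$ is $$\mathcal{E}_{a,\sigma}(\rho):=a\rho+(1-a)\sigma-\sqrt{a(1-a)}\;i[\rho,\sigma],\qquad [\rho,\sigma]:=\rho\sigma-\sigma\rho .$$ It equals $\operatorname{Tr}_2\big(U_a(\rho\otimes\sigma)U_a^\dagger\big)$, where $U_a=\sqrt a\,I+i\sqrt{1-a}\,S$ and $S$ is the swap operator on $\mathbb{C}^d\otimes\mathbb{C}^d$, so its output is a density matrix. The minimum output entropy of a channel $\mathcal{E}$ is $H_{\min}(\mathcal{E}):=\min_{\rho\in\mathcal{D}(\mathbb{C}^d)}H(\mathcal{E}(\rho))$. *)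

(* Defs.v *)
From HB Require Import structures.
From mathcomp Require Import all_boot all_order all_algebra.
From mathcomp Require Import sesquilinear spectral complex.
From mathcomp Require Import all_classical all_reals all_analysis.

Set Implicit Arguments.
Unset Strict Implicit.
Unset Printing Implicit Defensive.

Import Order.TTheory GRing.Theory Num.Theory.
Local Open Scope classical_set_scope.
Local Open Scope complex_scope.
Local Open Scope sesquilinear_scope.
Local Open Scope ring_scope.

Definition possemidef (R : realType) (d : nat) (A : 'M[R[i]]_d) : Prop :=
  A \is hermsymmx /\ forall v : 'cV[R[i]]_d, 0 <= (v ^t* *m A *m v) 0 0.

Definition density (R : realType) (d : nat) : set 'M[R[i]]_d :=
  [set rho | possemidef rho /\ \tr rho = 1].
Arguments density : clear implicits.

(* Functional calculus along the decomposition of [orthomx_spectralP],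
     A = invmx (spectralmx A) *m diag_mx (spectral_diag A) *m spectralmx A,
   which holds for every normal A. On a zero eigenvalue [ln] has an irrelevant
   finite value: [rho *m logmx rho] has eigenvalue 0 there. *)
Definition logmx (R : realType) (d : nat) (A : 'M[R[i]]_d) : 'M[R[i]]_d :=
  invmx (spectralmx A)
    *m diag_mx (map_mx (fun z : R[i] => (ln (complex.Re z))%:C)
                  (spectral_diag A))
    *m spectralmx A.

(* For a Hermitian [rho] the trace is real; [Re] only brings it back to [R]. *)
Definition entropy (R : realType) (d : nat) (rho : 'M[R[i]]_d) : R :=
  - complex.Re (\tr (rho *m logmx rho)).

Definition commutator (R : realType) (d : nat) (A B : 'M[R[i]]_d) :
    'M[R[i]]_d :=
  A *m B - B *m A.

Definition qadd (R : realType) (d : nat) (a : R) (sigma rho : 'M[R[i]]_d) :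
    'M[R[i]]_d :=
  a%:C *: rho + (1 - a)%:C *: sigma
    - ((Num.sqrt (a * (1 - a)))%:C * 'i%C) *: commutator rho sigma.

Definition is_min (R : realType) (A : set R) (m : R) : Prop :=
  A m /\ lbound A m.

Definition is_min_output_entropy (R : realType) (d : nat)
    (E : 'M[R[i]]_d -> 'M[R[i]]_d) (m : R) : Prop :=
  is_min [set entropy (E rho) | rho in density R d] m.

Definition g (R : realType) (x : R) : R :=
  (x + 1) * ln (x + 1) - x * ln x.

(* [g] is a bijection of [0, +oo[ onto itself; [ginv] is its inverse there,
   with junk values at negative arguments. *)
Definition ginv (R : realType) : R -> R :=
  'pinv_(fun=> 0) `[0, +oo[ (@g R).

(* In the three functions below, [Hs] stands for the entropy of sigma. *)
Definition G_lin (R : realType) (a Hs H0 : R) : R :=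
  a * H0 + (1 - a) * Hs.

Definition G_exp (R : realType) (c a Hs H0 : R) : R :=
  c^-1 * ln (a * expR (c * H0) + (1 - a) * expR (c * Hs)).

Definition G_g (R : realType) (c a Hs H0 : R) : R :=
  c^-1 * g (a * ginv (c * H0) + (1 - a) * ginv (c * Hs)).

(* Main.v *)
Require Import Defs.
From HB Require Import structures.
From mathcomp Require Import all_boot all_order all_algebra.
From mathcomp Require Import sesquilinear spectral complex.
From mathcomp Require Import all_classical all_reals all_analysis.
From mathcomp Require Import perm ring lra.

Set Implicit Arguments.
Unset Strict Implicit.
Unset Printing Implicit Defensive.

Import Order.TTheory GRing.Theory Num.Theory.
Import numFieldNormedType.Exports.
Local Open Scope classical_set_scope.
Local Open Scope ring_scope.

(** Let l and m be the decreasing spectra of rho and sigma. The spectrum of the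
    output is majorized by a l + (1 - a) m. In an eigenbasis of the output, the
    sum of its k largest eigenvalues is a combination of the traces of the
    compressions of rho and sigma to the first k coordinates, plus a commutator
    term which only sees the off-diagonal blocks; and the trace of a compression
    falls short of the Ky Fan bound by at least the squared norm of the
    off-diagonal block, which absorbs the commutator.

    So it remains to show, for the Shannon entropy H on decreasing probability
    vectors, that H, exp (c H) and the inverse of g at c H are concave. Along a
    segment, Cauchy-Schwarz gives H'^2 <= - V H'', where V is the variance of
    the surprisal. Concavity of exp (c H) thus follows from V <= ln^2 d, and that
    of n := ginv (c H) from V <= (d - 1) n (n + 1) ln^2 (1 + 1 / n). For the
    latter put n_i = r_i (r_0 + ... + r_(i-1)): the pairs (j, i) with j < i
    contribute to V at most n_i ln^2 (1 + 1 / n_i), the g (n_i) add up to at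
    most H, and the two are compared by Jensen's inequality. *)

(** * Logarithmic inequalities *)

Section LogExp.
Variable R : realType.
Implicit Types x y z : R.

Lemma le_of_derive_ge0 (f f' : R -> R) (a b : R) : a <= b ->
  (forall x, a <= x <= b -> is_derive x 1 f (f' x)) ->
  (forall x, a <= x <= b -> 0 <= f' x) -> f a <= f b.
Proof.
move=> ab df f'0.
have fd : forall x, x \in `]a, b[%R -> is_derive x 1 f (f' x).
  by move=> x; rewrite in_itv/= => /andP[/ltW ax /ltW xb]; apply: df; rewrite ax xb.
have fc : {within `[a, b], continuous f}.
  apply: derivable_within_continuous => x; rewrite in_itv/= => xab.
  by have := df x xab; case.
have [c cab fE] := MVT_segment ab fd fc.
rewrite -subr_ge0 fE mulr_ge0 ?subr_ge0// f'0//.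
Qed.

Lemma drvC (c x : R) : is_derive x 1 (fun=> c) 0.
Proof. exact: is_derive_cst. Qed.

Lemma drv_id x : is_derive x 1 (fun z : R => z) 1.
Proof. exact: is_derive_id. Qed.

Lemma drvD (f h : R -> R) (a b x : R) : is_derive x 1 f a -> is_derive x 1 h b ->
  is_derive x 1 (fun z => f z + h z) (a + b).
Proof. by move=> ? ?; exact: is_deriveD. Qed.

Lemma drvN (f : R -> R) (a x : R) : is_derive x 1 f a ->
  is_derive x 1 (fun z => - f z) (- a).
Proof. by move=> ?; exact: is_deriveN. Qed.

Lemma drvB (f h : R -> R) (a b x : R) : is_derive x 1 f a -> is_derive x 1 h b ->
  is_derive x 1 (fun z => f z - h z) (a - b).
Proof. by move=> ? ?; exact: is_deriveB. Qed.

Lemma drvM (f h : R -> R) (a b x : R) : is_derive x 1 f a -> is_derive x 1 h b ->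
  is_derive x 1 (fun z => f z * h z) (f x * b + h x * a).
Proof. by move=> ? ?; exact: is_deriveM. Qed.

Lemma drvV (f : R -> R) (a x : R) : f x != 0 -> is_derive x 1 f a ->
  is_derive x 1 (fun z => (f z)^-1) (- (f x) ^- 2 * a).
Proof. by move=> ? ?; exact: is_deriveV. Qed.

Lemma drv_comp (f h : R -> R) (a b x : R) : is_derive x 1 f a ->
  is_derive (f x) 1 h b -> is_derive x 1 (fun z => h (f z)) (b * a).
Proof. by move=> ? ?; exact: is_derive1_comp. Qed.

Lemma drv_ln (f : R -> R) (a x : R) : 0 < f x -> is_derive x 1 f a ->
  is_derive x 1 (fun z => ln (f z)) ((f x)^-1 * a).
Proof. by move=> f0 df; apply: drv_comp => //; exact: is_derive1_ln. Qed.

Lemma ln_le_subr1 x : 0 < x -> ln x <= x - 1.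
Proof.
move=> x0; have := @le_ln1Dx R (x - 1); rewrite (_ : 1 + (x - 1) = x); last by ring.
by apply; lra.
Qed.

Lemma subr1V_le_ln x : 0 < x -> 1 - x^-1 <= ln x.
Proof.
move=> x0; have xV0 : 0 < x^-1 by rewrite invr_gt0.
have := ln_le_subr1 xV0; rewrite lnV ?posrE//; lra.
Qed.

(** With z = exp (2 u) this is tanh u <= u for u >= 0. The difference vanishes at 1 and has a
    nonnegative derivative. *)
Lemma ln_ge_tanh z : 1 <= z -> 2 * (z - 1) / (z + 1) <= ln z.
Proof.
move=> z1; rewrite -subr_ge0.
pose f (z : R) := ln z - 2 * (z - 1) / (z + 1).
pose f' (z : R) := (z - 1) ^+ 2 / (z * (z + 1) ^+ 2).
have -> : 0 = f 1 by rewrite /f ln1 !subrr mulr0 mul0r subr0.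
apply: (@le_of_derive_ge0 f f' 1 z z1) => x /andP[x1 _].
  have x0 : 0 < x by lra.
  have x10 : x + 1 != 0 by lra.
  rewrite /f.
  have D := drvB (drv_ln (f := id) x0 (drv_id x))
    (drvM (drvM (drvC 2 _) (drvB (drv_id _) (drvC 1 _)))
          (drvV (f := fun z => z + 1) x10 (drvD (drv_id _) (drvC 1 _)))).
  by apply: (is_derive_eq D); rewrite /f' /=; field; rewrite x10; lra.
rewrite /f' divr_ge0 ?sqr_ge0// mulr_ge0 ?sqr_ge0//; lra.
Qed.
(** With z = exp u this is u <= sinh u for u >= 0. *)
Lemma ln_le_sinh z : 1 <= z -> ln z <= (z - z^-1) / 2.
Proof.
move=> z1; rewrite -subr_ge0.
pose f (z : R) := (z - z^-1) / 2 - ln z.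
pose f' (z : R) := (z - 1) ^+ 2 / (2 * z ^+ 2).
have -> : 0 = f 1 by rewrite /f ln1 invr1 !subrr mul0r subr0.
apply: (@le_of_derive_ge0 f f' 1 z z1) => x /andP[x1 _].
  have x0 : 0 < x by lra.
  have xn0 : x != 0 by lra.
  rewrite /f.
  have := is_derive1_ln x0 => ?.
  have D := drvB (drvM (drvB (drv_id _) (drvV (f := id) xn0 (drv_id _)))
    (drvC 2^-1 _)) (drv_ln (f := id) x0 (drv_id x)).
  by apply: (is_derive_eq D); rewrite /f' /=; field.
by rewrite /f' divr_ge0 ?sqr_ge0// mulr_ge0 ?sqr_ge0//.
Qed.

Lemma lnMp x y : 0 < x -> 0 < y -> ln (x * y) = ln x + ln y.
Proof. by move=> x0 y0; rewrite lnM. Qed.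

Lemma ln2_ge : 68 / 100 <= ln 2 :> R.
Proof.
(* Factors near 1 keep [ln_ge_tanh] sharp: 2/7 + 2/5 = 24/35 exceeds 68/100, whereas a single use at
   2 gives only 2/3. *)
have -> : 2 = (4/3) * (3/2) :> R by field.
rewrite lnMp; [|lra|lra].
have h1 : 2 * (4/3 - 1) / (4/3 + 1) <= ln (4/3) :> R by apply: ln_ge_tanh; lra.
have h2 : 2 * (3/2 - 1) / (3/2 + 1) <= ln (3/2) :> R by apply: ln_ge_tanh; lra.
have e1 : 2 * (4/3 - 1) / (4/3 + 1) = 2/7 :> R by field.
have e2 : 2 * (3/2 - 1) / (3/2 + 1) = 2/5 :> R by field.
lra.
Qed.

Lemma ln9_ge : 2 <= ln 9 :> R.
Proof.
have -> : 9 = (2 * (3/2)) ^+ 2 :> R by field.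
rewrite lnXn; last lra.
rewrite lnMp; [|lra|lra].
have h2 : 2 * (3/2 - 1) / (3/2 + 1) <= ln (3/2) :> R by apply: ln_ge_tanh; lra.
have e2 : 2 * (3/2 - 1) / (3/2 + 1) = 2/5 :> R by field.
have := ln2_ge; rewrite -mulr_natr; lra.
Qed.

Lemma ln13_4_le : ln (13 / 4) <= 12 / 10 :> R.
Proof.
(* (4/3)^4 = 256/81 falls just short of 13/4, so the crude bound on the remaining factor costs
   little. *)
have -> : 13/4 = (4/3) ^+ 4 * (1053/1024) :> R by field.
rewrite lnMp; [|by rewrite exprn_gt0//; lra|lra].
rewrite lnXn; last lra.
have h1 : ln (4/3) <= (4/3 - (4/3)^-1) / 2 :> R by apply: ln_le_sinh; lra.
have h2 : ln (1053/1024) <= 1053/1024 - 1 :> R by apply: ln_le_subr1; lra.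
have e1 : (4/3 - (4/3)^-1) / 2 = 7/24 :> R by field.
rewrite -[ln (4 / 3) *+ 4]mulr_natr; lra.
Qed.

(* The tangents of exp at ln (13/4) and of its reflection add up to a line
   which stays above 2 w / ln 2. *)
Lemma le_ln2_cosh (w : R) : 0 <= w -> 2 * w <= ln 2 * (expR w + expR (- w)).
Proof.
move=> w0; set w1 : R := ln (13/4).
have p : expR w1 = 13/4 by rewrite lnK ?posrE; lra.
have q : expR (- w1) = 4/13 by rewrite expRN p invf_div.
have h1 : (13/4) * (1 + (w - w1)) <= expR w.
  rewrite (_ : expR w = (13/4) * expR (w - w1)); last first.
    by rewrite -p -expRD addrC subrK.
  by rewrite ler_pM2l ?expR_ge1Dx//; lra.
have h2 : (4/13) * (1 + (w1 - w)) <= expR (- w).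
  rewrite (_ : expR (- w) = (4/13) * expR (w1 - w)); last first.
    by rewrite -q -expRD addKr.
  by rewrite ler_pM2l ?expR_ge1Dx//; lra.
(* The slope 153/52 below is 13/4 - 4/13, and 68/100 times it just exceeds 2. *)
have := ln13_4_le; rewrite -/w1 => h3; have h4 := ln2_ge.
have h5 : (153/52) * w <= expR w + expR (- w) by lra.
have : (68/100) * ((153/52) * w) <= ln 2 * (expR w + expR (- w)).
  apply: ler_pM => //; lra.
lra.
Qed.

(** Writing x = m exp w and y = m exp (- w), with m the geometric mean, reduces this to the square
    of [le_ln2_cosh]. It bounds what one pair contributes to the variance of the surprisal. *)
Lemma mul_sqr_lnB_le x y : 0 < x -> 0 < y ->
  x * y * (ln x - ln y) ^+ 2 <= ln 2 ^+ 2 * (x + y) ^+ 2.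
Proof.
wlog xy : x y / y <= x.
  move=> H x0 y0; have [/H|/ltW/H] := leP y x; first exact.
  by rewrite (mulrC y) -sqrrN opprB (addrC y); apply.
move=> x0 y0.
set w := (ln x - ln y) / 2; set m := expR ((ln x + ln y) / 2).
have ex : x = m * expR w.
  by rewrite -expRD -[LHS]lnK ?posrE//; congr expR; rewrite /w; field.
have ey : y = m * expR (- w).
  by rewrite -expRD -[LHS]lnK ?posrE//; congr expR; rewrite /w; field.
have -> : ln x - ln y = 2 * w by rewrite /w; field.
have w0 : 0 <= w by rewrite /w divr_ge0// subr_ge0 ler_ln ?posrE.
have -> : x * y = m ^+ 2.
  by rewrite {1}ex {1}ey mulrACA expRxMexpNx_1 mulr1.
rewrite (_ : ln 2 ^+ 2 * (x + y) ^+ 2 =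
             m ^+ 2 * (ln 2 * (expR w + expR (- w))) ^+ 2); last first.
  by rewrite [in LHS]ex [in LHS]ey; ring.
apply: ler_wpM2l; first exact: sqr_ge0.
have h := le_ln2_cosh w0.
by rewrite lerXn2r ?nnegrE//; [lra|apply: le_trans h; lra].
Qed.

(** For u <= 2, squaring 1 - u / 2 <= exp (- u / 2) gives u^2 / 4 <= u - 1 + exp (- u), and 2 l >=
    4. For u > 2, already u - 1 >= u / 2, and l >= u. *)
Lemma sqr_le_expRN (l u : R) : 2 <= l -> u <= l ->
  u ^+ 2 <= 2 * l * (u - 1 + expR (- u)).
Proof.
move=> l2 ul; have [u2|u2] := leP u 2.
  have h : (1 - u / 2) ^+ 2 <= expR (- u).
    rewrite (_ : - u = 2%:R * (- u / 2)); last by field.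
    rewrite expRM_natl lerXn2r ?nnegrE ?expR_ge0//; first lra.
    by rewrite -mulNr expR_ge1Dx.
  have : u ^+ 2 / 4 <= u - 1 + expR (- u).
    have -> : u ^+ 2 / 4 = u - 1 + (1 - u / 2) ^+ 2 by field.
    by rewrite lerD2l.
  have := sqr_ge0 u; nra.
have := expR_gt0 (- u); nra.
Qed.

End LogExp.

(** * Entropy and variance of the surprisal *)

Section Surprisal.
Variable R : realType.
Implicit Types x y z : R.

Definition eta x : R := - (x * ln x).

Lemma eta0 : eta 0 = 0. Proof. by rewrite /eta mul0r oppr0. Qed.
Lemma eta1 : eta 1 = 0. Proof. by rewrite /eta ln1 mulr0 oppr0. Qed.

Lemma eta_ge0 x : x <= 1 -> 0 <= x -> 0 <= eta x.
Proof. by move=> x1 x0; rewrite /eta oppr_ge0 mulr_ge0_le0// ln_le0. Qed.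

Lemma g0 : g (0 : R) = 0. Proof. by rewrite /g add0r ln1 mulr0 mul0r subrr. Qed.

(** The right side is the entropy lost when outcomes of probabilities x and y are merged. With S = x
    + y and p = x y, the difference of the sides is x (1 - y) ln (S / x) + y (1 - x) ln (S / y) + 2
    p ln S - (p + 1) ln (p + 1), and every logarithm is bounded by a rational function. *)
Lemma g_mul_le x y : 0 <= x -> 0 <= y -> x + y <= 1 ->
  g (x * y) <= eta x + eta y - eta (x + y).
Proof.
move=> + + S1; rewrite le_eqVlt => /predU1P[<- _|x0].
  by rewrite mul0r add0r eta0 g0 add0r subrr.
rewrite le_eqVlt => /predU1P[<-|y0].
  by rewrite mulr0 addr0 eta0 g0 addr0 subrr.
have x1 : x <= 1 by lra.
have y1 : y <= 1 by lra.
set S := x + y in S1 *; set p := x * y.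
have S0 : 0 < S by rewrite addr_gt0.
have p0 : 0 < p by rewrite mulr_gt0.
have h1 : (p + 1) * ln (p + 1) <= (p + 1) * p.
  apply: ler_wpM2l; first lra.
  by have := @ln_le_subr1 R (p + 1) (ltr_wpDl (ltW p0) ltr01); rewrite addrK.
have hp : ln p = ln x + ln y by rewrite lnMp.
have tanh z : 0 < z -> z <= S -> 2 * (S - z) / (S + z) <= ln S - ln z.
  move=> z0 zS; have := @ln_ge_tanh R (S / z).
  rewrite ln_div ?posrE// ler_pdivlMr// mul1r => /(_ zS); apply: le_trans.
  by rewrite le_eqVlt; apply/orP; left; apply/eqP; field; rewrite !gt_eqF//; lra.
have hx := tanh x x0 (ltac:(rewrite /S; lra)).
have hy := tanh y y0 (ltac:(rewrite /S; lra)).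
have hS := subr1V_le_ln S0.
rewrite /g /eta hp.
have h2 : x * (1 - y) * (2 * (S - x) / (S + x)) <= x * (1 - y) * (ln S - ln x).
  by apply: ler_wpM2l => //; apply: mulr_ge0; lra.
have h3 : y * (1 - x) * (2 * (S - y) / (S + y)) <= y * (1 - x) * (ln S - ln y).
  by apply: ler_wpM2l => //; apply: mulr_ge0; lra.
have h4 : 2 * p * (1 - S^-1) <= 2 * p * ln S by apply: ler_wpM2l => //; lra.
have h5 : 0 <= x * (1 - y) * (2 * (S - x) / (S + x)) +
    y * (1 - x) * (2 * (S - y) / (S + y)) + 2 * p * (1 - S^-1) - p - p ^+ 2.
  (* Both summands of the new numerator are nonnegative because S <= 1 and p <= S^2. *)
  have -> : x * (1 - y) * (2 * (S - x) / (S + x)) +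
    y * (1 - x) * (2 * (S - y) / (S + y)) + 2 * p * (1 - S^-1) - p - p ^+ 2 =
    p * (2 * (1 - S) * (S ^+ 2 - p) + S * p * (3 - 2 * S ^+ 2 - p))
      / (S * (S + x) * (S + y)).
    rewrite /p /S; field.
    by rewrite !gt_eqF//; lra.
  have pS : p <= S ^+ 2 by rewrite /p /S; nra.
  have S21 : S ^+ 2 <= 1 by rewrite expr_le1// ltW.
  apply: divr_ge0; last by rewrite !mulr_ge0//; lra.
  apply: mulr_ge0; first exact: ltW.
  apply: addr_ge0; apply: mulr_ge0; try lra.
  by apply: mulr_ge0; lra.
rewrite /p /S in h1 h2 h3 h4 h5 *; nra.
Qed.

(** A vector is a sequence of which only the first n entries count, so that inductions on n need no
    reindexing. *)
Definition ent n (r : nat -> R) := \sum_(i < n) eta (r i).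
Definition surprisal_var n (r : nat -> R) :=
  \sum_(i < n) r i * ln (r i) ^+ 2 - ent n r ^+ 2.

(** Lagrange's identity with weights r: a variance as a sum over pairs, each pair j < i occurring
    once. *)
Lemma var_pairs n (r l : nat -> R) :
  (\sum_(i < n) r i) * (\sum_(i < n) r i * l i ^+ 2) - (\sum_(i < n) r i * l i) ^+ 2 =
  \sum_(i < n) r i * \sum_(j < i) r j * (l j - l i) ^+ 2.
Proof.
elim: n => [|n IH]; first by rewrite !big_ord0; ring.
rewrite !big_ord_recr /= -IH.
have -> : \sum_(j < n) r j * (l j - l n) ^+ 2 =
   \sum_(i < n) r i * l i ^+ 2 - 2 * l n * (\sum_(i < n) r i * l i)
   + l n ^+ 2 * \sum_(i < n) r i.
  rewrite !mulr_sumr -sumrN -!big_split /=; apply: eq_bigr => i _; ring.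
ring.
Qed.

Lemma surprisal_var_pairs n (r : nat -> R) : \sum_(i < n) r i = 1 ->
  surprisal_var n r =
  \sum_(i < n) r i * \sum_(j < i) r j * (ln (r j) - ln (r i)) ^+ 2.
Proof.
move=> r1; rewrite -(var_pairs n r (fun i => ln (r i))) r1 mul1r /surprisal_var.
by congr (_ - _); rewrite /ent sumrN sqrrN.
Qed.

(** Each square lies in n - 1 pairs, and the cross terms are the square of the sum less the
    squares. *)
Lemma sum_sqrD n (r : nat -> R) :
  \sum_(i < n) \sum_(j < i) (r i + r j) ^+ 2 + 2 * \sum_(i < n) r i ^+ 2 =
  n%:R * (\sum_(i < n) r i ^+ 2) + (\sum_(i < n) r i) ^+ 2.
Proof.
elim: n => [|n IH]; first by rewrite !big_ord0; ring.
rewrite !big_ord_recr /= -[n.+1%:R]natr1.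
have -> : \sum_(j < n) (r n + r j) ^+ 2 =
   n%:R * r n ^+ 2 + 2 * r n * (\sum_(i < n) r i) + \sum_(i < n) r i ^+ 2.
  rewrite (_ : n%:R * r n ^+ 2 = \sum_(j < n) r n ^+ 2); last first.
    by rewrite sumr_const card_ord mulr_natl.
  rewrite mulr_sumr -!big_split /=.
  by apply: eq_bigr => i _; ring.
have e (A B C c x : R) : A + 2 * B = c * B + C ^+ 2 ->
    A + (c * x ^+ 2 + 2 * x * C + B) + 2 * (B + x ^+ 2) =
    (c + 1) * (B + x ^+ 2) + (C + x) ^+ 2.
  by move=> h; transitivity (A + 2 * B + (c * x ^+ 2 + 2 * x * C + B + 2 * x ^+ 2));
    [|rewrite h]; ring.
exact: e.
Qed.

Definition prob n (r : nat -> R) :=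
  (forall i, (i < n)%N -> 0 <= r i) /\ \sum_(i < n) r i = 1.

Lemma prob_le1 n r : prob n r -> forall i, (i < n)%N -> r i <= 1.
Proof.
move=> [r0 r1] i ni; rewrite -r1 (bigD1 (Ordinal ni))//= lerDl.
by apply: sumr_ge0 => j _; exact: r0.
Qed.

Lemma sum_pairs_le n (r : nat -> R) : (2 <= n)%N -> prob n r ->
  \sum_(i < n) \sum_(j < i) (r i + r j) ^+ 2 <= n%:R - 1.
Proof.
move=> n2 pr; have [r0 r1] := pr; have := sum_sqrD n r; rewrite r1 expr1n.
have B1 : \sum_(i < n) r i ^+ 2 <= 1.
  rewrite -r1; apply: ler_sum => i _; rewrite expr2 ler_piMr ?r0//.
  exact: (prob_le1 pr).
have nn : 2 <= n%:R :> R by rewrite ler_nat.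
have e (A B c : R) : B <= 1 -> 2 <= c -> A + 2 * B = c * B + 1 -> A <= c - 1.
  by move=> ? ? ?; nra.
exact: e.
Qed.

Lemma mul_ln2_le m k n : (0 < n)%N -> (2 ^ k <= n ^ m)%N ->
  k%:R * ln 2 <= m%:R * ln n%:R :> R.
Proof.
move=> n0 h.
have : ln ((2 ^ k)%:R) <= ln ((n ^ m)%:R) :> R.
  by rewrite ler_ln ?posrE ?ltr0n ?expn_gt0 ?n0// ler_nat.
by rewrite !natrX !lnXn ?ltr0n// -[_ *+ k]mulr_natl -[_ *+ m]mulr_natl.
Qed.

(** In these dimensions the pairwise bound ln^2 2 (r_i + r_j)^2 suffices for the variance. Each case
    is certified by a fraction k / m <= ln n / ln 2 whose square is at least n - 1. *)
Lemma sqr_ln2_le n : (2 <= n <= 8)%N -> (n%:R - 1) * ln 2 ^+ 2 <= ln n%:R ^+ 2 :> R.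
Proof.
move=> /andP[n2 n8].
have L0 : 0 < ln 2 :> R by have := ln2_ge R; lra.
have key (k m : nat) : (0 < m)%N -> (2 ^ k <= n ^ m)%N ->
    (n * m ^ 2 <= k ^ 2 + m ^ 2)%N -> (n%:R - 1) * ln 2 ^+ 2 <= ln n%:R ^+ 2 :> R.
  move=> m0 h1; rewrite -(ler_nat R) natrD natrM !natrX => h2.
  have := @mul_ln2_le m k n (ltac:(by case: (n) n2)) h1 => h3.
  have mm : 0 < m%:R :> R by rewrite ltr0n.
  have : (k%:R * ln 2) ^+ 2 <= (m%:R * ln n%:R) ^+ 2 :> R.
    rewrite lerXn2r ?nnegrE// ?mulr_ge0 ?ler0n ?ln_ge0 ?ler1n//.
    by case: (n) n2.
  rewrite !exprMn => h4.
  rewrite -(ler_pM2l (exprn_gt0 2 mm)); apply: le_trans h4.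
  rewrite mulrA ler_wpM2r ?sqr_ge0//; lra.
case: n n2 n8 key => [|[|[|[|[|[|[|[|[|n]]]]]]]]]// _ _ key.
- exact: (key 1 1)%N.
- exact: (key 3 2)%N.
- exact: (key 2 1)%N.
- exact: (key 2 1)%N.
- exact: (key 5 2)%N.
- exact: (key 5 2)%N.
- exact: (key 3 1)%N.
Qed.

(** Up to n = 8 the pairs are bounded one by one. From n = 9 on, ln n >= 2 and the second moment
    alone is at most ln^2 n. *)
Lemma surprisal_var_le_sqr_ln n (r : nat -> R) : (2 <= n)%N -> prob n r ->
  surprisal_var n r <= ln n%:R ^+ 2.
Proof.
move=> n2 pr; have [r0 r1] := pr.
have [n8|n9] := leqP n 8.
  apply: le_trans (sqr_ln2_le (introT andP (conj n2 n8))).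
  rewrite surprisal_var_pairs//.
  apply: (@le_trans _ _ (ln 2 ^+ 2 * \sum_(i < n) \sum_(j < i) (r i + r j) ^+ 2)).
    rewrite mulr_sumr; apply: ler_sum => i _; rewrite !mulr_sumr; apply: ler_sum => j _.
    have jn : (j < n)%N by exact: ltn_trans (ltn_ord j) (ltn_ord i).
    have := r0 i (ltn_ord i); rewrite le_eqVlt => /predU1P[<-|ri].
      by rewrite mul0r mulr_ge0 ?sqr_ge0.
    have := r0 j jn; rewrite le_eqVlt => /predU1P[<-|rj].
      by rewrite mul0r mulr0 mulr_ge0 ?sqr_ge0.
    by have := mul_sqr_lnB_le ri rj; rewrite -mulrA -(sqrrN (ln (r j) - _)) opprB.
  by rewrite mulrC ler_wpM2r ?sqr_ge0 ?sum_pairs_le.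
set l := ln n%:R.
have n0 : 0 < n%:R :> R by rewrite ltr0n; case: (n) n2.
have l2 : 2 <= l.
  by apply: le_trans (ln9_ge R) _; rewrite ler_ln ?posrE ?ler_nat.
rewrite /surprisal_var.
suff : \sum_(i < n) r i * ln (r i) ^+ 2 <= l ^+ 2 by have := sqr_ge0 (ent n r); lra.
(* With v = ln (n r_i), the bound of [sqr_le_expRN] on v^2 has linear part 2 l v, which cancels the
   cross term of (v - l)^2. The resulting terms sum to exactly l^2. *)
apply: (@le_trans _ _ (\sum_(i < n) (r i * (l ^+ 2 - 2 * l) + 2 * l / n%:R))).
  apply: ler_sum => i _; have := r0 i (ltn_ord i); rewrite le_eqVlt => /predU1P[<-|ri].
    by rewrite !mul0r add0r divr_ge0 ?ler0n//; lra.
  set v := ln (r i) + l.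
  have vl : v <= l by rewrite gerDr ln_le0// (prob_le1 pr).
  have hexp : expR (- v) = (r i * n%:R)^-1.
    by rewrite /v /l -lnMp// expRN lnK ?posrE ?mulr_gt0.
  have h : r i * v ^+ 2 <= r i * (2 * l * (v - 1 + (r i * n%:R)^-1)).
    by rewrite ler_pM2l// -hexp; exact: sqr_le_expRN.
  have -> : ln (r i) = v - l by rewrite /v addrK.
  have e : r i * (2 * l * (v - 1 + (r i * n%:R)^-1)) =
      r i * (2 * l * (v - 1)) + 2 * l / n%:R.
    by field; rewrite !gt_eqF.
  rewrite e in h; lra.
rewrite big_split /= -mulr_suml r1 sumr_const card_ord -mulr_natr.
by rewrite le_eqVlt; apply/orP; left; apply/eqP; field; rewrite gt_eqF.
Qed.

End Surprisal.

(** * The function g *)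

Section Bose.
Variable R : realType.
Implicit Types x y z : R.

Definition g' x : R := ln (x + 1) - ln x.
(* [bose_var x] is the variance of the surprisal of the geometric distribution
   with mean [x], whose entropy is [g x]; [bose_slope x] is its derivative with
   respect to that entropy. *)
Definition bose_var x : R := x * (x + 1) * g' x ^+ 2.
Definition bose_slope x : R := (2 * x + 1) * g' x - 2.

Lemma is_derive_g x : 0 < x -> is_derive x 1 (@g R) (g' x).
Proof.
move=> x0; have x10 : 0 < x + 1 by lra.
have D := drvB (drvM (drvD (drv_id x) (drvC 1 _))
    (drv_ln (f := fun z => z + 1) x10 (drvD (drv_id x) (drvC 1 _))))
  (drvM (drv_id x) (drv_ln (f := id) x0 (drv_id x))).
by apply: (is_derive_eq D); rewrite /g' /=; field; rewrite !gt_eqF.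
Qed.

Lemma is_derive_g' x : 0 < x -> is_derive x 1 g' ((x + 1)^-1 - x^-1).
Proof.
move=> x0; have x10 : 0 < x + 1 by lra.
have D := drvB (drv_ln (f := fun z => z + 1) x10 (drvD (drv_id x) (drvC 1 _)))
  (drv_ln (f := id) x0 (drv_id x)).
by apply: (is_derive_eq D); rewrite /=; ring.
Qed.

Lemma is_derive_bose_var x : 0 < x ->
  is_derive x 1 bose_var (bose_slope x * g' x).
Proof.
move=> x0; have x10 : 0 < x + 1 by lra.
have D := drvM (drvM (drv_id x) (drvD (drv_id x) (drvC 1 _)))
  (drvM (is_derive_g' x0) (is_derive_g' x0)).
by apply: (is_derive_eq D); rewrite /= /bose_slope; field; rewrite !gt_eqF.
Qed.

Lemma is_derive_bose_slope x : 0 < x ->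
  is_derive x 1 bose_slope (2 * g' x - (2 * x + 1) / (x * (x + 1))).
Proof.
move=> x0; have x10 : 0 < x + 1 by lra.
have D := drvB (drvM (drvD (drvM (drvC 2 _) (drv_id x)) (drvC 1 _)) (is_derive_g' x0))
  (drvC 2 _).
by apply: (is_derive_eq D); rewrite /=; field; rewrite !gt_eqF.
Qed.

Lemma g'E x : 0 < x -> g' x = ln ((x + 1) / x).
Proof. by move=> x0; rewrite /g' ln_div ?posrE//; lra. Qed.

Lemma g'_gt0 x : 0 < x -> 0 < g' x.
Proof. by move=> x0; rewrite /g' subr_gt0 ltr_ln ?posrE//; lra. Qed.

(** [ln_ge_tanh] at (x + 1) / x reads g' x >= 2 / (2 x + 1). *)
Lemma bose_slope_ge0 x : 0 < x -> 0 <= bose_slope x.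
Proof.
move=> x0; have x10 : 0 < x + 1 by lra.
have h : 1 <= (x + 1) / x by rewrite ler_pdivlMr//; lra.
have := ln_ge_tanh h; rewrite -g'E// /bose_slope subr_ge0.
have -> : 2 * ((x + 1) / x - 1) / ((x + 1) / x + 1) = 2 / (2 * x + 1).
  by field; rewrite !gt_eqF//; lra.
by rewrite ler_pdivrMr 1?mulrC//; lra.
Qed.

(** The derivative of [bose_slope] is nonpositive by [ln_le_sinh] at (x + 1) / x. *)
Lemma bose_slope_anti x y : 0 < x -> x <= y -> bose_slope y <= bose_slope x.
Proof.
move=> x0 xy; rewrite -lerN2.
apply: (@le_of_derive_ge0 R (fun z => - bose_slope z)
  (fun z => - (2 * g' z - (2 * z + 1) / (z * (z + 1)))) x y xy) => z /andP[xz _].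
  by apply: drvN; apply: is_derive_bose_slope; lra.
have z0 : 0 < z by lra.
have h : 1 <= (z + 1) / z by rewrite ler_pdivlMr//; lra.
have := ln_le_sinh h; rewrite -g'E//.
have -> : ((z + 1) / z - ((z + 1) / z)^-1) / 2 = (2 * z + 1) / (z * (z + 1)) / 2.
  by field; rewrite !gt_eqF//; lra.
lra.
Qed.

(* Concavity of [bose_var] as a function of [g], in tangent form. *)
Lemma bose_var_tangent m x : 0 < m -> 0 < x ->
  bose_var x <= bose_var m + bose_slope m * (g x - g m).
Proof.
move=> m0 x0.
pose f z := bose_slope m * g z - bose_var z.
suff : f m <= f x by rewrite /f; lra.
have df z : 0 < z -> is_derive z 1 f ((bose_slope m - bose_slope z) * g' z).
  move=> z0; have D := drvB
    (drvM (drvC (bose_slope m) z) (is_derive_g z0)) (is_derive_bose_var z0).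
  by apply: (is_derive_eq D); rewrite /=; ring.
(* As [bose_slope] decreases, f falls up to m and rises after it. *)
move: f df => f df; have [xm|/ltW mx] := leP x m.
  rewrite -lerN2.
  apply: (@le_of_derive_ge0 R (fun z => - f z)
    (fun z => - ((bose_slope m - bose_slope z) * g' z)) x m xm) => z /andP[xz zm].
    by apply: drvN; apply: df; lra.
  have z0 : 0 < z by lra.
  rewrite -mulNr; apply: mulr_ge0; last exact/ltW/g'_gt0.
  by rewrite opprB subr_ge0 bose_slope_anti.
apply: (le_of_derive_ge0 mx (f' := fun z => (bose_slope m - bose_slope z) * g' z)) =>
  z /andP[mz zx]; first by apply: df; lra.
have z0 : 0 < z by lra.
apply: mulr_ge0; last exact/ltW/g'_gt0.
by rewrite subr_ge0 bose_slope_anti.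
Qed.

(** An explicit rate for the vanishing of g at 0, obtained from x ln x >= x - 1; it serves the limit
    in [bose_var_tangent0]. *)
Lemma g_sqr_le x : 0 < x -> x <= 1 -> g (x ^+ 2) <= 4 * x.
Proof.
move=> x0 x1; have x20 : 0 < x ^+ 2 by rewrite exprn_gt0.
have h1 : (x ^+ 2 + 1) * ln (x ^+ 2 + 1) <= (x ^+ 2 + 1) * x ^+ 2.
  apply: ler_wpM2l; first lra.
  by have := @ln_le_subr1 R (x ^+ 2 + 1) (ltr_wpDl (ltW x20) ltr01); rewrite addrK.
have h2 := subr1V_le_ln x0.
have h3 : - (x ^+ 2 * ln (x ^+ 2)) <= 2 * x.
  rewrite lnXn// -[ln x *+ 2]mulr_natl.
  have : 2 * x ^+ 2 * (1 - x^-1) <= 2 * x ^+ 2 * ln x by apply: ler_wpM2l => //; lra.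
  have -> : 2 * x ^+ 2 * (1 - x^-1) = 2 * x ^+ 2 - 2 * x by field; rewrite gt_eqF.
  lra.
have x2x : x ^+ 2 <= x by rewrite expr2 ler_piMl// ltW.
have : x ^+ 2 * x ^+ 2 <= x * 1 by apply: ler_pM; lra.
rewrite /g; lra.
Qed.

Lemma bose_var_ge0 x : 0 <= x -> 0 <= bose_var x.
Proof. by move=> x0; rewrite /bose_var mulr_ge0 ?sqr_ge0// mulr_ge0//; lra. Qed.

(** At x = 0, where g has no derivative, the inequality is a limit of [bose_var_tangent] at small
    positive points. *)
Lemma bose_var_tangent0 m x : 0 < m -> 0 <= x ->
  bose_var x <= bose_var m + bose_slope m * (g x - g m).
Proof.
move=> m0; rewrite le_eqVlt => /predU1P[<-|]; last exact: bose_var_tangent.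
rewrite /bose_var !mul0r g0 sub0r -/(bose_var m).
set A := (X in 0 <= X); rewrite leNgt; apply/negP => A0.
set b := bose_slope m; have b0 : 0 <= b by exact: bose_slope_ge0.
(* Chosen so that b g (e^2) <= 4 b e < - A, which contradicts the tangent inequality at e^2. *)
pose e := Num.min 1 (- A / (8 * b + 1)).
have e0 : 0 < e by rewrite lt_min ltr01 divr_gt0//; lra.
have e1 : e <= 1 by rewrite ge_min lexx.
have eA : e * (8 * b + 1) <= - A.
  by rewrite -ler_pdivlMr ?ge_min ?lexx ?orbT//; lra.
have e20 : 0 < e ^+ 2 by rewrite exprn_gt0.
have := bose_var_tangent m0 e20; have := bose_var_ge0 (ltW e20).
have := g_sqr_le e0 e1; rewrite -/b.
have : 0 <= b * e by rewrite mulr_ge0// ltW.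
move: A0; rewrite /A -/b => A0 h1 h2 h3 h4.
have : b * g (e ^+ 2) <= b * (4 * e) by apply: ler_wpM2l.
move: eA; rewrite /A -/b; lra.
Qed.

(** [g_mul_le] applied to each entry and the sum of those before it; the values of [eta] at the
    prefix sums telescope. *)
Lemma sum_g_prefix_le n (r : nat -> R) : (forall i, (i < n)%N -> 0 <= r i) ->
  \sum_(i < n) r i <= 1 ->
  \sum_(i < n) g (r i * \sum_(j < i) r j) <= ent n r - eta (\sum_(i < n) r i).
Proof.
elim: n => [|n IH] r0 r1; first by rewrite /ent !big_ord0 eta0 subrr.
have S0 : 0 <= \sum_(i < n) r i 
  by apply: sumr_ge0 => i _; apply: r0; exact: leqW (ltn_ord i).
have rn : 0 <= r n by exact: r0.
rewrite big_ord_recr /= in r1.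
have r1' : \sum_(i < n) r i <= 1 by lra.
have := IH (fun i h => r0 i (leqW h)) r1'.
have := g_mul_le rn S0; rewrite addrC => /(_ r1).
by rewrite /ent !big_ord_recr /=; lra.
Qed.

Definition descending n (r : nat -> R) :=
  forall i j, (i <= j)%N -> (j < n)%N -> r j <= r i.

(** With S the inner sum of the r_j, r_i <= r_j <= 1 and S <= 1 give 0 <= ln r_j - ln r_i <= - ln
    (r_i S) <= g' (r_i S). *)
Lemma bose_var_term n (r : nat -> R) (i : 'I_n) : prob n r -> descending n r ->
  r i * \sum_(j < i) r j * (ln (r j) - ln (r i)) ^+ 2 <=
  bose_var (r i * \sum_(j < i) r j).
Proof.
move=> pr sr; have [r0 r1] := pr.
have S0 : 0 <= \sum_(j < i) r j.
  by apply: sumr_ge0 => j _; apply: r0; exact: ltn_trans (ltn_ord j) (ltn_ord i).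
have := r0 i (ltn_ord i); rewrite le_eqVlt => /predU1P[<-|ri].
  by rewrite !mul0r /bose_var !mul0r.
have S1 : \sum_(j < i) r j <= 1.
  rewrite -r1 (big_ord_widen n r (ltnW (ltn_ord i))).
  rewrite [leRHS](bigID (fun k : 'I_n => (k < i)%N))/= lerDl.
  by apply: sumr_ge0 => j _; exact: r0.
move: S0; rewrite le_eqVlt => /predU1P[S0|S0].
  rewrite -S0 mulr0 /bose_var !mul0r.
  have z j : (j < i)%N -> r j = 0.
    move=> ji; have /eqP := esym S0; rewrite psumr_eq0.
      by move=> /allP/(_ (Ordinal ji)); rewrite mem_index_enum => /(_ isT)/eqP.
    by move=> k _; apply: r0; exact: ltn_trans (ltn_ord k) (ltn_ord i).
  by rewrite big1 ?mulr0// => j _; rewrite z ?mul0r.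
set S := \sum_(j < i) r j in S0 S1 *.
have m0 : 0 < r i * S by rewrite mulr_gt0.
rewrite /bose_var -mulrA -/S.
apply: (@le_trans _ _ (r i * S * g' (r i * S) ^+ 2)); last first.
  by rewrite ler_wpM2l ?ler_peMl ?sqr_ge0//; lra.
rewrite -mulrA; apply: ler_wpM2l; first exact: ltW.
rewrite {1}/S mulr_suml; apply: ler_sum => j _.
have jn : (j < n)%N by exact: ltn_trans (ltn_ord j) (ltn_ord i).
have rji : r i <= r j by apply: sr => //; exact: ltnW.
have rj0 : 0 < r j by lra.
rewrite ler_wpM2l ?r0//.
have rj1 := prob_le1 pr jn.
have h1 : ln (r i) <= ln (r j) by rewrite ler_ln ?posrE.
have h2 : ln (r j) <= 0 by rewrite ln_le0.
have h3 : ln (r i * S) <= ln (r i) by rewrite ler_ln ?posrE// ler_piMr// ltW.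
have h4 : 0 <= ln (r i * S + 1) by rewrite ln_ge0//; lra.
rewrite -/S lerXn2r ?nnegrE /g'; lra.
Qed.

(** Jensen's inequality through the tangent at m. Index 0 has no predecessor, so n terms remain, and
    their values of g add up to at most the entropy n g(m). *)
Lemma surprisal_var_le_bose_var n (r : nat -> R) m : prob n.+1 r ->
  descending n.+1 r -> 0 < m -> n%:R * g m = ent n.+1 r ->
  surprisal_var n.+1 r <= n%:R * bose_var m.
Proof.
move=> pr sr m0 mE; have [r0 r1] := pr.
rewrite surprisal_var_pairs// big_ord_recl big_ord0 mulr0 add0r.
have := sum_g_prefix_le r0 (_ : \sum_(i < n.+1) r i <= 1); rewrite r1 => /(_ (lexx 1)).
rewrite eta1 subr0 -mE big_ord_recl big_ord0 mulr0 g0 add0r => h.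
apply: (@le_trans _ _ (\sum_(i < n) (bose_var m - bose_slope m * g m +
   bose_slope m * g (r (lift ord0 i) * \sum_(j < lift ord0 i) r j)))).
  apply: ler_sum => i _; apply: (le_trans (bose_var_term _ pr sr)).
  have := bose_var_tangent0 m0 (x := r (lift ord0 i) * \sum_(j < lift ord0 i) r j) _.
  rewrite mulrBr => H; apply: (le_trans (H _)); last by lra.
  apply: mulr_ge0; first exact: r0.
  apply: sumr_ge0 => j _; apply: r0.
  exact: ltn_trans (ltn_ord j) (ltn_ord (lift ord0 i)).
rewrite big_split /= sumr_const card_ord -mulr_natl -mulr_sumr.
have := ler_wpM2l (bose_slope_ge0 m0) h; lra.
Qed.

End Bose.

(** * The inverse of g: monotonicity, continuity and derivative *)

Section GInverse.
Variable R : realType.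
Implicit Types x y z : R.

Lemma eta_continuous : continuous (@eta R).
Proof.
move=> x; have [x0|x0|->] := ltgtP x 0.
(* [ln] is 0 at negative arguments, so [eta] vanishes there. *)
- have h : \forall y \near x, 0 = eta y.
    near=> y; rewrite /eta ln0 ?mulr0 ?oppr0//; apply: ltW.
    by near: y; exact: lt_nbhsl.
  apply: (cvg_trans (near_eq_cvg h)).
  by rewrite /continuous_at /eta (ln0 (ltW x0)) mulr0 oppr0; exact: cvg_cst.
- rewrite /continuous_at /eta; apply: cvgN; apply: cvgM; first exact: cvg_id.
  exact: continuous_ln.
- rewrite /continuous_at eta0; apply/cvgrPdist_lt => e e0.
  (* For y = s^2 with 0 < s < d, - y ln y <= 2 s - 2 s^2 < 2 d <= e. *)
  pose d : R := Num.min 1 (e / 2).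
  have d0 : 0 < d by rewrite lt_min ltr01 divr_gt0.
  near=> y; rewrite sub0r normrN.
  have yd : `|y| < d ^+ 2.
    by near: y; apply: (@nbhs0_lt _ R); rewrite exprn_gt0.
  have [y0|y0] := leP y 0; first by rewrite /eta ln0// mulr0 oppr0 normr0.
  rewrite gtr0_norm// in yd.
  have d1 : d <= 1 by rewrite ge_min lexx.
  have s0 : 0 < Num.sqrt y by rewrite sqrtr_gt0.
  have yE : y = Num.sqrt y ^+ 2 by rewrite sqr_sqrtr// ltW.
  have sd : Num.sqrt y < d by rewrite -ltr_sqr ?nnegrE ?ltW// -yE.
  have s1 : Num.sqrt y <= 1 by lra.
  have de : d <= e / 2 by rewrite ge_min lexx orbT.
  have y1 : y <= 1 by rewrite yE expr_le1// ltW.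
  rewrite ger0_norm; last by rewrite eta_ge0// ltW.
  rewrite /eta; set s := Num.sqrt y in yE s0 sd s1; rewrite yE.
  rewrite lnXn// -[ln s *+ 2]mulr_natl.
  have : 2 * s ^+ 2 * (1 - s^-1) <= 2 * s ^+ 2 * ln s.
    by apply: ler_wpM2l; [rewrite mulr_ge0 ?sqr_ge0|exact: subr1V_le_ln].
  have -> : 2 * s ^+ 2 * (1 - s^-1) = 2 * s ^+ 2 - 2 * s by field; rewrite gt_eqF.
  have : 0 < s ^+ 2 by rewrite exprn_gt0.
  lra.
Unshelve. all: by end_near. Qed.

Lemma g_continuous : continuous (@g R).
Proof.
have -> : @g R = fun x => eta x - eta (x + 1).
  by apply/funext => x; rewrite /g /eta; ring.
move=> x; apply: continuousB; first exact: eta_continuous.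
apply: (@continuous_comp _ _ _ (fun x => x + 1)); last exact: eta_continuous.
by apply: continuousD; [exact: cvg_id|exact: cst_continuous].
Qed.

Lemma g_lt x y : 0 <= x -> x < y -> g x < g y.
Proof.
rewrite le_eqVlt => /predU1P[<-|x0] xy.
  rewrite g0 /g -subr_gt0.
  have h1 := g'_gt0 xy; have h2 : 0 < ln (y + 1) by rewrite ln_gt0//; lra.
  have : 0 < y * g' y by rewrite mulr_gt0.
  rewrite /g'; lra.
have dg z : z \in `]x, y[ -> is_derive z 1 (@g R) (g' z).
  by rewrite in_itv/= => /andP[xz _]; apply: is_derive_g; lra.
have [c] := MVT xy dg (continuous_subspaceT g_continuous).
rewrite in_itv/= => /andP[xc _] E.
by rewrite -subr_gt0 E mulr_gt0 ?g'_gt0//; lra.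
Qed.

Lemma g_le x y : 0 <= x -> x <= y -> g x <= g y.
Proof. by move=> x0; rewrite le_eqVlt => /predU1P[<-//|/(g_lt x0)/ltW]. Qed.

Lemma g_surj y : 0 <= y -> exists2 x, 0 <= x & g x = y.
Proof.
(* g b = ln (b + 1) + b g' b exceeds ln b = y, so [0, b] is long enough for the intermediate value
   theorem. *)
move=> y0; pose b := expR y.
have b0 : 0 < b by exact: expR_gt0.
have gb : y <= g b.
  have h := g'_gt0 b0.
  have : 0 < b * g' b by rewrite mulr_gt0.
  have : y <= ln (b + 1) by rewrite -{1}[y]expRK ler_ln ?posrE// /b -?/b; lra.
  rewrite /g /g'; lra.
have [|c] := IVT (ltW b0) (continuous_subspaceT g_continuous) (v := y).
  by rewrite ge_min le_max gb g0 y0 orbT.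
by rewrite in_itv/= => /andP[c0 _] ce; exists c.
Qed.

Lemma g_surjO : set_surj `[0, +oo[ `[0, +oo[ (@g R).
Proof.
move=> y /=; rewrite in_itv/= andbT => /g_surj[x x0 xy].
by exists x => //=; rewrite in_itv/= andbT.
Qed.

Lemma ginvK y : 0 <= y -> g (ginv y) = y.
Proof.
by move=> y0; apply: (surjpK _ g_surjO); rewrite inE/= in_itv/= y0.
Qed.

Lemma g_inj x y : 0 <= x -> 0 <= y -> g x = g y -> x = y.
Proof.
move=> x0 y0 E; have [/(g_lt x0)|/(g_lt y0)|//] := ltgtP x y; rewrite E ltxx//.
Qed.

Lemma gK x : 0 <= x -> ginv (g x) = x.
Proof.
move=> x0; apply: pinvKV; last by rewrite inE/= in_itv/= x0.
move=> u v; rewrite !inE/= !in_itv/= !andbT; exact: g_inj.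
Qed.

Lemma ginv_ge0 y : 0 <= y -> 0 <= ginv y.
Proof. by move=> /g_surj[x x0 <-]; rewrite gK. Qed.

Lemma ginv_le x y : 0 <= x -> x <= y -> ginv x <= ginv y.
Proof.
move=> x0 xy; have y0 : 0 <= y by lra.
rewrite leNgt; apply/negP => /(g_lt (ginv_ge0 y0)); rewrite !ginvK//; lra.
Qed.

Lemma ginv_gt0 y : 0 < y -> 0 < ginv y.
Proof.
move=> y0; rewrite lt_def ginv_ge0 ?ltW// andbT; apply/eqP => E.
by have := ginvK (ltW y0); rewrite E g0; lra.
Qed.

Lemma g_ge0 x : 0 <= x -> 0 <= g x.
Proof. by move=> x0; rewrite -[leLHS](@g0 R) g_le. Qed.

Lemma maxgK x : 0 <= x -> ginv (Num.max (g x) 0) = x.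
Proof. by move=> x0; rewrite max_l ?gK ?g_ge0. Qed.

(** Truncating at 0 hides the junk values of [ginv] and gives a nondecreasing function on the whole
    line, whose continuity follows from its being inverse to g. *)
Lemma ginv_continuous : continuous (fun y => ginv (Num.max y 0) : R).
Proof.
move=> y; apply/cvgrPdist_le => e e0.
set G := fun y => ginv (Num.max y 0).
have GM u v : u <= v -> G u <= G v.
  move=> uv; apply: ginv_le; first by rewrite le_max lexx orbT.
  by rewrite ge_max !le_max uv lexx orbT.
have G0 u : 0 <= G u by apply: ginv_ge0; rewrite le_max lexx orbT.
have gG u : g (G u) = Num.max u 0 by apply: ginvK; rewrite le_max lexx orbT.
have hi : y < g (G y + e).
  have := @g_lt (G y) (G y + e) (G0 y); rewrite gG => /(_ (ltac:(lra))).
  by apply: le_lt_trans; rewrite le_max lexx.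
have lo : exists2 l, l < y & forall z, l < z -> G y - e <= G z.
  have [h|h] := leP (G y - e) 0.
    by exists (y - 1) => [|z _]; [lra|exact: le_trans h (G0 z)].
  exists (g (G y - e)).
    have := @g_lt (G y - e) (G y) (ltW h); rewrite gG => /(_ (ltac:(lra))).
    rewrite lt_max => /orP[//|]; have := g_ge0 (ltW h); lra.
  move=> z zl; have <- : G (g (G y - e)) = G y - e by exact/maxgK/ltW.
  by apply: GM; exact: ltW.
have [l ly lG] := lo.
near=> z; rewrite ler_distlC; apply/andP; split.
  by apply: lG; near: z; exact: lt_nbhsr.
have <- : G (g (G y + e)) = G y + e.
  by apply: maxgK; have := G0 y; lra.
by apply: GM; apply: ltW; near: z; exact: lt_nbhsl.
Unshelve. all: by end_near. Qed.

Lemma is_derive_ginv y : 0 < y ->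
  is_derive y 1 (fun y => ginv (Num.max y 0) : R) (g' (ginv y))^-1.
Proof.
move=> y0; have p0 := ginv_gt0 y0.
rewrite -{1}(ginvK (ltW y0)).
apply: (@is_derive_inverse R (@g R)).
- near=> x; have x0 : 0 < x by near: x; exact: lt_nbhsr.
  exact/maxgK/ltW.
- by near=> x; exact: g_continuous.
- exact: is_derive_g.
- by rewrite gt_eqF// g'_gt0.
Unshelve. all: by end_near. Qed.

End GInverse.

(** * Concavity along segments of probability vectors *)

Section Concavity.
Variable R : realType.
Implicit Types x y z t a c Q : R.

(** Derivatives are asked only inside the segment, since the entropy may fail to have one at the
    ends. The mean value theorem on [0, a] and on [a, 1] yields two slopes to compare. *)
Lemma concave_of_derive2 (f f1 f2 : R -> R) (a : R) : continuous f ->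
  (forall t : R, 0 < t < 1 -> is_derive t 1 f (f1 t)) ->
  (forall t : R, 0 < t < 1 -> is_derive t 1 f1 (f2 t)) ->
  (forall t : R, 0 < t < 1 -> f2 t <= 0) -> 0 <= a -> a <= 1 ->
  a * f 1 + (1 - a) * f 0 <= f a.
Proof.
move=> fc df1 df2 f20; rewrite le_eqVlt => /predU1P[<- _|a0].
  by rewrite mul0r add0r subr0 mul1r.
rewrite le_eqVlt => /predU1P[->|a1]; first by rewrite subrr mul0r addr0 mul1r.
have [|c1] := @MVT R f f1 0 a a0 _ (continuous_subspaceT fc).
  by move=> t; rewrite in_itv/= => /andP[t0 ta]; apply: df1; rewrite t0/=; lra.
rewrite in_itv/= => /andP[c10 c1a] E1.
have [|c2] := @MVT R f f1 a 1 a1 _ (continuous_subspaceT fc).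
  by move=> t; rewrite in_itv/= => /andP[t0 ta]; apply: df1; rewrite ta andbT; lra.
rewrite in_itv/= => /andP[c2a c21] E2.
have c12 : c1 <= c2 by lra.
have : - f1 c1 <= - f1 c2.
  apply: (@le_of_derive_ge0 R (fun z => - f1 z) (fun z => - f2 z)
    _ _ c12) => z /andP[h1 h2].
    by apply: drvN; apply: df2; apply/andP; split; lra.
  by rewrite oppr_ge0 f20//; apply/andP; split; lra.
rewrite lerN2 => h.
have : a * (1 - a) * (f1 c2 - f1 c1) <= 0.
  by rewrite mulr_ge0_le0 ?mulr_ge0//; lra.
have -> : a * (1 - a) * (f1 c2 - f1 c1) =
   a * (f1 c2 * (1 - a)) - (1 - a) * (f1 c1 * (a - 0)) by ring.
rewrite -E1 -E2; lra.
Qed.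

Definition mix (t : R) (l m : nat -> R) i := t * l i + (1 - t) * m i.

Lemma mix1 l m : mix 1 l m = l.
Proof. by apply/funext => i; rewrite /mix subrr mul0r addr0 mul1r. Qed.

Lemma mix0 l m : mix 0 l m = m.
Proof. by apply/funext => i; rewrite /mix subr0 mul0r add0r mul1r. Qed.

Lemma prob_mix n t l m : 0 <= t -> t <= 1 -> prob n l -> prob n m ->
  prob n (mix t l m).
Proof.
move=> t0 t1 [l0 l1] [m0 m1]; split.
  by move=> i ni; rewrite /mix addr_ge0// mulr_ge0 ?l0 ?m0//; lra.
by rewrite /mix big_split/= -!mulr_sumr l1 m1; ring.
Qed.

Lemma descending_mix n t l m : 0 <= t -> t <= 1 ->
  descending n l -> descending n m -> descending n (mix t l m).
Proof.
move=> t0 t1 sl sm i j ij jn; rewrite /mix lerD// ler_wpM2l ?sl ?sm//; lra.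
Qed.

Lemma ent_ge0 n (r : nat -> R) : prob n r -> 0 <= ent n r.
Proof.
move=> pr; apply: sumr_ge0 => i _; have [r0 _] := pr.
by apply: eta_ge0; [exact: (prob_le1 pr)|exact: r0].
Qed.

(** * Derivatives of the entropy along a segment *)

Section Segment.
Variables (n : nat) (l m : nat -> R).
Hypotheses (pl : prob n l) (pm : prob n m).

(** [h1] and [h2] are the first and second derivatives of [h] inside the segment. *)
Let h t := ent n (mix t l m).
Let h1 t := \sum_(i < n) (l i - m i) * (- ln (mix t l m i) - 1).
Let h2 t := \sum_(i < n) - ((l i - m i) ^+ 2 / mix t l m i).

(** An entry that vanishes inside the segment thus vanishes all along it, and the singularity of
    [ln] at 0 does no harm. *)
Lemma mix_eq0 t i : (i < n)%N -> 0 < t < 1 -> mix t l m i = 0 -> l i = 0 /\ m i = 0.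
Proof.
move=> ni /andP[t0 t1] /eqP; have [l0 _] := pl; have [m0 _] := pm.
rewrite /mix paddr_eq0 ?mulr_ge0 ?l0 ?m0//; [|lra..].
by rewrite !mulf_eq0 (gt_eqF t0) subr_eq0 (gt_eqF t1)/= => /andP[/eqP -> /eqP ->].
Qed.

Lemma mix_gt0 t i : (i < n)%N -> 0 < t < 1 -> mix t l m i != 0 -> 0 < mix t l m i.
Proof.
move=> ni /andP[t0 t1] h0; have [p0 _] := prob_mix (ltW t0) (ltW t1) pl pm.
by rewrite lt_def h0 p0.
Qed.

Lemma is_derive_mix t i : is_derive t 1 (fun t => mix t l m i) (l i - m i).
Proof.
have D := drvD (drvM (drv_id t) (drvC (l i) t))
  (drvM (drvB (drvC 1 t) (drv_id t)) (drvC (m i) t)).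
by apply: (is_derive_eq D); rewrite /=; ring.
Qed.

Lemma is_derive_sum_fun k (f f' : nat -> R -> R) t :
  (forall i, (i < k)%N -> is_derive t 1 (f i) (f' i t)) ->
  is_derive t 1 (fun t => \sum_(i < k) f i t) (\sum_(i < k) f' i t).
Proof.
elim: k => [|k IH] H.
  rewrite big_ord0 (_ : (fun t => _) = fun=> 0); first exact: drvC.
  by apply/funext => u; rewrite big_ord0.
rewrite big_ord_recr /= (_ : (fun t => _) = fun t => \sum_(i < k) f i t + f k t).
  by apply: drvD; [apply: IH => i ik; exact: H (leqW ik)|exact: H].
by apply/funext => u; rewrite big_ord_recr.
Qed.

Lemma ent_mix_continuous : continuous h.
Proof.
rewrite /h /ent; elim: n => [|k IH].
  rewrite (_ : (fun t => _) = fun=> 0); first exact: cst_continuous.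
  by apply/funext => u; rewrite big_ord0.
rewrite (_ : (fun t => _) =
  fun t => \sum_(i < k) eta (mix t l m i) + eta (mix t l m k)).
  move=> t; apply: cvgD; first exact: IH.
  apply: (@continuous_comp _ _ _ (fun t => mix t l m k)); last exact: eta_continuous.
  have [d _] := is_derive_mix t k.
  by apply: differentiable_continuous; apply/derivable1_diffP.
by apply/funext => u; rewrite big_ord_recr.
Qed.

Lemma is_derive_ent_mix t : 0 < t < 1 -> is_derive t 1 h (h1 t).
Proof.
move=> t01; apply: (@is_derive_sum_fun n
  (fun i t => eta (mix t l m i))
  (fun i t => (l i - m i) * (- ln (mix t l m i) - 1))) => i ni.
have [E|/(mix_gt0 ni t01) p] := eqVneq (mix t l m i) 0.
  have [li mi] := mix_eq0 ni t01 E.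
  rewrite li mi subrr mul0r (_ : (fun t => _) = fun=> 0); first exact: drvC.
  by apply/funext => u; rewrite /mix li mi !mulr0 addr0 eta0.
have D := drvN (drvM (is_derive_mix t i)
  (drv_ln (f := fun t => mix t l m i) p (is_derive_mix t i))).
by apply: (is_derive_eq D); rewrite /=; field; rewrite gt_eqF.
Qed.

Lemma is_derive2_ent_mix t : 0 < t < 1 -> is_derive t 1 h1 (h2 t).
Proof.
move=> t01; apply: (@is_derive_sum_fun n
  (fun i t => (l i - m i) * (- ln (mix t l m i) - 1))
  (fun i t => - ((l i - m i) ^+ 2 / mix t l m i))) => i ni.
have [E|/(mix_gt0 ni t01) p] := eqVneq (mix t l m i) 0.
  have [li mi] := mix_eq0 ni t01 E.
  rewrite li mi subrr expr0n mul0r oppr0.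
  rewrite (_ : (fun t => _) = fun=> 0); first exact: drvC.
  by apply/funext => u; rewrite mul0r.
have D := drvM (drvC (l i - m i) t) (drvB (drvN
  (drv_ln (f := fun t => mix t l m i) p (is_derive_mix t i))) (drvC 1 t)).
by apply: (is_derive_eq D); rewrite /=; field; rewrite gt_eqF.
Qed.

Lemma ent_mix_derive2_le0 t : 0 < t < 1 -> h2 t <= 0.
Proof.
move=> /andP[t0 t1]; rewrite /h2 sumrN oppr_le0; apply: sumr_ge0 => i _.
have [p0 _] := prob_mix (ltW t0) (ltW t1) pl pm.
by rewrite divr_ge0 ?sqr_ge0 ?p0.
Qed.

(* Cauchy-Schwarz: h' is the covariance, under the mixture, of the surprisal
   with the relative derivative of the mixture. *)
Lemma sqr_derive_ent_mix t Q : 0 < t < 1 -> 0 < Q ->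
  surprisal_var n (mix t l m) <= Q -> h1 t ^+ 2 <= Q * (- h2 t).
Proof.
move=> t01 Q0 VQ; have /andP[t0 t1] := t01.
have [p0 p1] := prob_mix (ltW t0) (ltW t1) pl pm.
set r := mix t l m in p0 p1 VQ *; set H := ent n r.
set D := h1 t.
have [_ l1] := pl; have [_ m1] := pm.
have d0 : \sum_(i < n) (l i - m i) = 0 by rewrite sumrB l1 m1 subrr.
have dE : D = - \sum_(i < n) (l i - m i) * ln (r i).
  rewrite /D /h1 -/r.
  rewrite (eq_bigr (fun i : 'I_n => - ((l i - m i) * ln (r i)) - (l i - m i))).
    by rewrite sumrB d0 subr0 sumrN.
  by move=> i _; ring.
have HE : \sum_(i < n) r i * ln (r i) = - H by rewrite /H /ent sumrN opprK.
(* With V the variance, this expands to Q^2 (- h2) - 2 Q D^2 + D^2 V, which V <= Q turns into Q (Q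
   (- h2) - D^2) >= 0. *)
have : 0 <= \sum_(i < n) r i * (Q * ((l i - m i) / r i) + D * (ln (r i) + H)) ^+ 2.
  by apply: sumr_ge0 => i _; rewrite mulr_ge0 ?sqr_ge0 ?p0.
have -> : \sum_(i < n) r i * (Q * ((l i - m i) / r i) + D * (ln (r i) + H)) ^+ 2 =
   \sum_(i < n) (Q ^+ 2 * ((l i - m i) ^+ 2 / r i)
      + 2 * Q * D * ((l i - m i) * ln (r i)) + 2 * Q * D * H * (l i - m i)
      + D ^+ 2 * (r i * ln (r i) ^+ 2) + 2 * D ^+ 2 * H * (r i * ln (r i))
      + D ^+ 2 * H ^+ 2 * r i).
  apply: eq_bigr => i _.
  have [E|/(mix_gt0 (ltn_ord i) t01) p] := eqVneq (r i) 0.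
    have [li mi] := mix_eq0 (ltn_ord i) t01 E.
    by rewrite E li mi; ring.
  by field; rewrite gt_eqF.
rewrite !big_split /= -!mulr_sumr d0 HE p1.
move: VQ; rewrite /surprisal_var -/H.
have -> : \sum_(i < n) (l i - m i) * ln (r i) = - D by rewrite dE opprK.
have -> : \sum_(i < n) (l i - m i) ^+ 2 / r i = - h2 t by rewrite /h2 sumrN opprK.
set A := \sum_(i < n) _ => VQ h0.
have : D ^+ 2 * (A - H ^+ 2) <= D ^+ 2 * Q by apply: ler_wpM2l; rewrite ?sqr_ge0.
move=> h3; have : 0 <= Q * (Q * (- h2 t) - D ^+ 2) by nra.
by rewrite pmulr_rge0// subr_ge0.
Qed.

Lemma ent_mix_concave a : 0 <= a -> a <= 1 ->
  a * ent n l + (1 - a) * ent n m <= ent n (mix a l m).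
Proof.
move=> a0 a1; have := @concave_of_derive2 h h1 h2 a ent_mix_continuous
  is_derive_ent_mix is_derive2_ent_mix ent_mix_derive2_le0 a0 a1.
by rewrite /h mix1 mix0.
Qed.

(** The second derivative is a positive multiple of h2 + c h1^2, nonpositive by [sqr_derive_ent_mix]
    with Q = 1 / c. *)
Lemma expR_ent_mix_concave a c : 0 <= a -> a <= 1 -> 0 < c ->
  (forall t : R, 0 < t < 1 -> surprisal_var n (mix t l m) <= c^-1) ->
  a * expR (c * ent n l) + (1 - a) * expR (c * ent n m) <=
  expR (c * ent n (mix a l m)).
Proof.
move=> a0 a1 c0 V.
have := @concave_of_derive2 (fun t => expR (c * h t))
  (fun t => c * h1 t * expR (c * h t))
  (fun t => c * expR (c * h t) * (h2 t + c * h1 t ^+ 2)) a.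
rewrite /h mix1 mix0; apply => //.
- move=> t; apply: (@continuous_comp _ _ _ (fun t => c * h t));
    last exact: continuous_expR.
  by apply: cvgM; [exact: cvg_cst|exact: ent_mix_continuous].
- move=> t t01.
  have D := drv_comp (f := fun t => c * h t) (drvM (drvC c t) (is_derive_ent_mix t01))
    (is_derive_expR _).
  by apply: (is_derive_eq D); rewrite /=; ring.
- move=> t t01.
  have D := drvM (drvM (drvC c t) (is_derive2_ent_mix t01))
    (drv_comp (f := fun t => c * h t) (drvM (drvC c t) (is_derive_ent_mix t01))
    (is_derive_expR _)).
  by apply: (is_derive_eq D); rewrite /=; ring.
- move=> t t01; have := sqr_derive_ent_mix t01 (Q := c^-1).
  rewrite invr_gt0 => /(_ c0 (V t t01)).
  rewrite ler_pdivlMl// => h'.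
  apply: mulr_ge0_le0; last by lra.
  by apply: mulr_ge0; [exact: ltW|exact: expR_ge0].
Qed.

(** As g' has derivative - 1 / (x (x + 1)), the second derivative of F = ginv (c h) is a positive
    multiple of h2 + c h1^2 / bose_var F. It is nonpositive by [sqr_derive_ent_mix] with Q =
    bose_var F / c. *)
Lemma ginv_ent_mix_concave a c : 0 <= a -> a <= 1 -> 0 < c ->
  (forall t : R, 0 < t < 1 -> 0 < ent n (mix t l m) /\
     surprisal_var n (mix t l m) <= bose_var (ginv (c * ent n (mix t l m))) / c) ->
  a * ginv (c * ent n l) + (1 - a) * ginv (c * ent n m) <=
  ginv (c * ent n (mix a l m)).
Proof.
move=> a0 a1 c0 V.
pose F t := ginv (Num.max (c * h t) 0).
have FE t : 0 <= t -> t <= 1 -> F t = ginv (c * h t).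
  move=> t0 t1; rewrite /F max_l//; apply: mulr_ge0; first exact: ltW.
  by apply: ent_ge0; exact: prob_mix.
have ch t : 0 < t < 1 -> 0 < c * h t by move=> /V[? _]; rewrite mulr_gt0.
have F0 t : 0 < t < 1 -> 0 < F t.
  by move=> t01; rewrite /F max_l ?ginv_gt0 ?ch//; exact/ltW/ch.
have dF t : 0 < t < 1 -> is_derive t 1 F (c * h1 t / g' (F t)).
  move=> t01; have p := ch t t01.
  have D := drv_comp (f := fun t => c * h t) (drvM (drvC c t) (is_derive_ent_mix t01))
    (is_derive_ginv p).
  by apply: (is_derive_eq D); rewrite /= /F max_l; [ring|exact: ltW].
have hc : continuous (fun t => c * h t).
  by move=> t; apply: cvgM; [exact: cvg_cst|exact: ent_mix_continuous].
have Fc : continuous F.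
  by move=> t; exact: (continuous_comp (hc t) (@ginv_continuous R (c * h t))).
have := @concave_of_derive2 F (fun t => c * h1 t / g' (F t))
  (fun t => c / g' (F t) * (h2 t + c * h1 t ^+ 2 / bose_var (F t))) a.
rewrite !FE ?ler01//; rewrite /h mix1 mix0; apply => //.
- move=> t t01; have Ft := F0 t t01; have gF := g'_gt0 Ft.
  have D := drvM (drvM (drvC c t) (is_derive2_ent_mix t01))
    (drvV (f := fun t => g' (F t)) (lt0r_neq0 gF)
      (drv_comp (dF t t01) (is_derive_g' Ft))).
  apply: (is_derive_eq D); rewrite /= /bose_var; field.
  by rewrite !gt_eqF//; lra.
- move=> t t01; have Ft := F0 t t01; have gF := g'_gt0 Ft.
  have Bp : 0 < bose_var (F t).
    by rewrite /bose_var mulr_gt0 ?exprn_gt0// mulr_gt0//; lra.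
  have [_ Vt] := V t t01; have /andP[t0 t1] := t01.
  have {}Vt : surprisal_var n (mix t l m) <= bose_var (F t) / c.
    by rewrite (FE _ (ltW t0) (ltW t1)).
  have := sqr_derive_ent_mix t01 (divr_gt0 Bp c0) Vt => h'.
  apply: mulr_ge0_le0; first by rewrite divr_ge0// ltW.
  have : c * h1 t ^+ 2 / bose_var (F t) <= - h2 t.
    rewrite ler_pdivrMr// mulrC -ler_pdivlMr//.
    by apply: (le_trans h'); rewrite le_eqVlt; apply/orP; left; apply/eqP; ring.
  lra.
Qed.

End Segment.

End Concavity.

(** * Majorization *)

Section Majorization.
Variable R : realType.
Implicit Types x y z t a c Q : R.

(** Summation by parts as an induction: raising the factor of a nonnegative prefix sum to the next c
    only increases it. *)
Lemma abel_sum_le n (c x : nat -> R) :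
  (forall i j, (i <= j)%N -> (j <= n)%N -> c i <= c j) ->
  (forall k, (k <= n.+1)%N -> 0 <= \sum_(i < k) x i) ->
  \sum_(i < n.+1) c i * x i <= c n * \sum_(i < n.+1) x i.
Proof.
elim: n => [|n IH] cm xs; first by rewrite !big_ord_recr !big_ord0/= !add0r.
rewrite big_ord_recr [in leRHS]big_ord_recr /= mulrDr lerD2r.
apply: (le_trans (IH _ _)).
- by move=> i j ij jn; apply: cm => //; exact: leqW.
- by move=> k kn; apply: xs; exact: leqW.
- by apply: ler_wpM2r; [apply: xs|exact: cm].
Qed.

Lemma prefix_sum n (f : nat -> R) i : (i <= n)%N ->
  \sum_(j < n) f j = \sum_(j < i) f j + \sum_(i <= j < n) f j.
Proof.
move=> ni; rewrite -(big_mkord xpredT f) -(big_mkord xpredT f).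
by rewrite (big_cat_nat (leq0n i) ni).
Qed.

(** The concave function [eta] lies below its tangent at x. *)
Lemma gibbs_term x y : 0 < x -> 0 <= y ->
  eta y - eta x <= (- ln x - 1) * (y - x).
Proof.
move=> x0; rewrite le_eqVlt => /predU1P[<-|y0].
  by rewrite eta0 /eta; lra.
have xy0 : 0 < x / y by rewrite divr_gt0.
have := ln_le_subr1 xy0; rewrite ln_div ?posrE// => h.
have : y * (ln x - ln y) <= y * (x / y - 1) by rewrite ler_pM2l.
have -> : y * (x / y - 1) = x - y by field; rewrite gt_eqF.
rewrite /eta; lra.
Qed.

(** Schur concavity: the tangent bounds at p have slopes that increase along the index, and r - p
    has nonnegative prefix sums and total 0, so [abel_sum_le] applies. *)
Lemma ent_le_of_majorized n (p r : nat -> R) : prob n p -> prob n r ->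
  descending n p ->
  (forall k, (k <= n)%N -> \sum_(i < k) p i <= \sum_(i < k) r i) ->
  ent n r <= ent n p.
Proof.
case: n => [|n]; first by move=> *; rewrite /ent !big_ord0.
move=> pp pr sp maj; have [p0 p1] := pp; have [r0 r1] := pr.
pose B := \sum_(i < n.+1) - ln (p i).
have lnp i : (i < n.+1)%N -> 0 <= - ln (p i).
  by move=> ni; rewrite oppr_ge0 ln_le0// (prob_le1 pp).
have BM i : (i < n.+1)%N -> - ln (p i) <= B.
  move=> ni; rewrite /B (bigD1 (Ordinal ni))//= lerDl.
  by apply: sumr_ge0 => j _; exact: lnp.
(* As [ln 0] is 0 by convention, - ln p_i is replaced at vanishing entries by an upper bound B of
   the others, which keeps c monotone. *)
pose c i := if p i == 0 then B else - ln (p i).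
have cm i j : (i <= j)%N -> (j <= n)%N -> c i <= c j.
  move=> ij jn; have ni := leq_ltn_trans ij (jn : (j < n.+1)%N).
  have pji := sp i j ij jn.
  have pi0 := p0 i ni; have pj0 := p0 j jn; rewrite /c.
  have [pj|pj] := eqVneq (p j) 0; first by case: ifP => // _; exact: BM.
  have pj' : 0 < p j by rewrite lt_def pj.
  have pi' : 0 < p i by lra.
  by rewrite gt_eqF// lerN2 ler_ln ?posrE.
(* Once p vanishes, its prefix sum is 1, so the larger one of r is 1 too. *)
have r0p i : (i < n.+1)%N -> p i = 0 -> r i = 0.
  move=> ni pi; apply/eqP; rewrite eq_le r0// andbT.
  have tail : \sum_(i <= j < n.+1) p j = 0.
    rewrite big_nat big1// => j /andP[ij jn]; apply/eqP; rewrite eq_le p0// andbT.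
    by rewrite -pi sp.
  have := prefix_sum p (ltnW ni); rewrite p1 tail addr0 => S1.
  have := prefix_sum r ni; rewrite r1 big_ord_recr /=.
  have : 0 <= \sum_(i.+1 <= j < n.+1) r j.
    by rewrite big_nat; apply: sumr_ge0 => j /andP[_ ?]; exact: r0.
  by have := maj i (ltnW ni); rewrite -S1; lra.
have := @abel_sum_le n (fun i => c i - 1) (fun i => r i - p i) _ _.
rewrite sumrB r1 p1 subrr mulr0 => H.
rewrite -subr_le0 /ent -sumrB; apply: le_trans (H _ _); first last.
- by move=> k kn; rewrite sumrB subr_ge0 maj.
- by move=> i j ij jn; rewrite lerD2r cm.
- apply: ler_sum => i _; rewrite /c; case: eqP => [pi|/eqP pi].
    by rewrite (r0p _ (ltn_ord i) pi) pi !subrr mulr0.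
  by apply: gibbs_term; [rewrite lt_def pi p0|exact: r0].
Qed.

(** * The three functions G at a mixture of spectra *)

Lemma G_lin_ent_mix n a l m : 0 <= a -> a <= 1 -> prob n l -> prob n m ->
  G_lin a (ent n m) (ent n l) <= ent n (mix a l m).
Proof. by move=> a0 a1 pl pm; exact: ent_mix_concave. Qed.

Lemma G_exp_ent_mix n a l m : (2 <= n)%N -> 0 <= a -> a <= 1 ->
  prob n l -> prob n m ->
  G_exp (ln n%:R ^+ 2)^-1 a (ent n m) (ent n l) <= ent n (mix a l m).
Proof.
move=> n2 a0 a1 pl pm; set c := (ln n%:R ^+ 2)^-1.
have c0 : 0 < c.
  by rewrite invr_gt0 exprn_gt0// ln_gt0// ltr1n.
have := expR_ent_mix_concave pl pm a0 a1 c0.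
have V t : 0 < t < 1 -> surprisal_var n (mix t l m) <= c^-1.
  move=> /andP[/ltW t0 /ltW t1]; rewrite invrK; apply: surprisal_var_le_sqr_ln => //.
  exact: prob_mix.
move=> /(_ V) h; rewrite /G_exp ler_pdivrMl//.
(* For a nonpositive sum [ln] is 0 by convention, which spares a proof of positivity. *)
have [S0|S0] := leP (a * expR (c * ent n l) + (1 - a) * expR (c * ent n m)) 0.
  rewrite ln0//; apply: mulr_ge0; first exact: ltW.
  by apply: ent_ge0; exact: prob_mix.
by rewrite -[leRHS]expRK ler_ln ?posrE// expR_gt0.
Qed.

Lemma ginv0 : ginv 0 = 0 :> R.
Proof. by rewrite -{1}(@g0 R) gK. Qed.

Lemma G_g_ent_mix n a l m : (2 <= n)%N -> 0 <= a -> a <= 1 ->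
  prob n l -> prob n m -> descending n l -> descending n m ->
  G_g (n%:R - 1)^-1 a (ent n m) (ent n l) <= ent n (mix a l m).
Proof.
case: n => [//|n] n2 a0 a1 pl pm sl sm.
rewrite -[n.+1%:R]natr1 addrK; set c := n%:R^-1.
have n0 : 0 < n%:R :> R by rewrite ltr0n; case: (n) n2.
have c0 : 0 < c by rewrite invr_gt0.
have Hl := ent_ge0 pl; have Hm := ent_ge0 pm.
have Hr := ent_ge0 (prob_mix a0 a1 pl pm).
have cl : 0 <= c * ent n.+1 l by rewrite mulr_ge0// ltW.
have cm : 0 <= c * ent n.+1 m by rewrite mulr_ge0// ltW.
rewrite /G_g ler_pdivrMl//.
have cr : 0 <= c * ent n.+1 (mix a l m) by rewrite mulr_ge0// ltW.
rewrite -[leRHS]ginvK//; apply: g_le.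
  by rewrite addr_ge0// mulr_ge0 ?ginv_ge0//; lra.
(* Unless both entropies vanish, concavity makes the entropy positive inside the segment, where
   [ginv] is then differentiable. *)
have [E|E] := eqVneq (ent n.+1 l + ent n.+1 m) 0.
  have -> : ent n.+1 l = 0 by lra.
  have -> : ent n.+1 m = 0 by lra.
  by rewrite !mulr0 ginv0 !mulr0 addr0 ginv_ge0.
apply: ginv_ent_mix_concave => // t t01; have /andP[t0 t1] := t01.
have ep : 0 < ent n.+1 (mix t l m).
  apply: lt_le_trans (ent_mix_concave pl pm (ltW t0) (ltW t1)).
  move: E; rewrite paddr_eq0// negb_and => /orP[E|E].
    apply: ltr_wpDr; first by rewrite mulr_ge0//; lra.
    by rewrite mulr_gt0// lt_def E.
  apply: ltr_wpDl; first by rewrite mulr_ge0//; lra.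
  by rewrite mulr_gt0// ?subr_gt0// lt_def E.
split=> //; rewrite /c invrK mulrC; apply: surprisal_var_le_bose_var.
- exact: prob_mix (ltW t0) (ltW t1) pl pm.
- exact: descending_mix (ltW t0) (ltW t1) sl sm.
- by apply: ginv_gt0; rewrite mulr_gt0.
- by rewrite ginvK ?mulrA ?mulfV ?mul1r ?gt_eqF// mulr_ge0 ?ltW// invr_gt0.
Qed.

(** This and the next two lemmas place the minimum of each G over [0, log d] at 0. *)
Lemma le_G_lin_0 a Hs H0 : 0 <= a -> 0 <= H0 -> G_lin a Hs 0 <= G_lin a Hs H0.
Proof. by move=> a0 h; rewrite /G_lin mulr0 lerD2r mulr_ge0. Qed.

Lemma le_G_exp_0 c a Hs H0 : 0 <= c -> 0 <= a -> a <= 1 -> 0 <= H0 ->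
  G_exp c a Hs 0 <= G_exp c a Hs H0.
Proof.
move=> c0 a0 a1 h; rewrite /G_exp; apply: ler_wpM2l; first by rewrite invr_ge0.
have le : a * expR (c * 0) + (1 - a) * expR (c * Hs) <=
    a * expR (c * H0) + (1 - a) * expR (c * Hs).
  by rewrite lerD2r ler_wpM2l// ler_expR ler_wpM2l.
have p : 0 < a * expR (c * 0) + (1 - a) * expR (c * Hs).
  rewrite mulr0 expR0 mulr1; have e0 := expR_gt0 (c * Hs).
  have [->|an0] := eqVneq a 0; first by rewrite subr0 mul1r add0r.
  have a0' : 0 < a by rewrite lt_def an0.
  by apply: ltr_wpDr => //; apply: mulr_ge0; lra.
by rewrite ler_ln ?posrE//; exact: lt_le_trans le.
Qed.

Lemma le_G_g_0 c a Hs H0 : 0 <= c -> 0 <= a -> a <= 1 -> 0 <= Hs -> 0 <= H0 ->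
  G_g c a Hs 0 <= G_g c a Hs H0.
Proof.
move=> c0 a0 a1 hs h; rewrite /G_g; apply: ler_wpM2l; first by rewrite invr_ge0.
have cs : 0 <= c * Hs by rewrite mulr_ge0.
have ch : 0 <= c * H0 by rewrite mulr_ge0.
apply: g_le.
  by rewrite mulr0 ginv0 mulr0 add0r mulr_ge0 ?ginv_ge0//; lra.
by rewrite lerD2r ler_wpM2l// ginv_le ?mulr0.
Qed.

End Majorization.

(** * Compressions of Hermitian matrices *)

Section Compression.
Local Open Scope complex_scope.
Local Open Scope sesquilinear_scope.
Variable R : realType.
Implicit Types z w : R[i].

Definition sqn z : R := complex.Re z ^+ 2 + complex.Im z ^+ 2.

Lemma sqn_ge0 z : 0 <= sqn z.
Proof. by rewrite addr_ge0 ?sqr_ge0. Qed.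

Lemma ReD z w : complex.Re (z + w) = complex.Re z + complex.Re w.
Proof. by case: z w => [a b] [c d]. Qed.

Lemma ImD z w : complex.Im (z + w) = complex.Im z + complex.Im w.
Proof. by case: z w => [a b] [c d]. Qed.

Lemma ReN z : complex.Re (- z) = - complex.Re z. Proof. by case: z. Qed.
Lemma ImN z : complex.Im (- z) = - complex.Im z. Proof. by case: z. Qed.

Lemma ReM z w : complex.Re (z * w) =
  complex.Re z * complex.Re w - complex.Im z * complex.Im w.
Proof. by case: z w => [a b] [c d]. Qed.

Lemma ImM z w : complex.Im (z * w) =
  complex.Re z * complex.Im w + complex.Im z * complex.Re w.
Proof. by case: z w => [a b] [c d]. Qed.

Lemma Re_conj z : complex.Re (Num.conj z) = complex.Re z. Proof. by case: z. Qed.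
Lemma Im_conj z : complex.Im (Num.conj z) = - complex.Im z. Proof. by case: z. Qed.

Lemma conj_real (x : R) : Num.conj (x%:C) = x%:C.
Proof. exact: conjc_real. Qed.

Lemma Re_sum (I : Type) (r : seq I) (P : pred I) (F : I -> R[i]) :
  complex.Re (\sum_(i <- r | P i) F i) = \sum_(i <- r | P i) complex.Re (F i).
Proof. exact: (big_morph _ ReD (erefl _)). Qed.

Lemma Im_sum (I : Type) (r : seq I) (P : pred I) (F : I -> R[i]) :
  complex.Im (\sum_(i <- r | P i) F i) = \sum_(i <- r | P i) complex.Im (F i).
Proof. exact: (big_morph _ ImD (erefl _)). Qed.

Lemma eq_ReIm z w : complex.Re z = complex.Re w -> complex.Im z = complex.Im w -> z = w.
Proof. by case: z w => [a b] [c d] /= -> ->. Qed.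

Lemma mulCJ z : z * Num.conj z = (sqn z)%:C.
Proof.
by apply: eq_ReIm; rewrite ?ReM ?ImM Re_conj Im_conj /sqn/=; ring.
Qed.

Lemma sqn_conj z : sqn (Num.conj z) = sqn z.
Proof. by rewrite /sqn Re_conj Im_conj sqrrN. Qed.

Lemma sqnN z : sqn (- z) = sqn z.
Proof. by rewrite /sqn ReN ImN !sqrrN. Qed.

(** The difference is the squared modulus of t z + (1 - t) w. *)
Lemma sqn_convex (t : R) z w :
  t * (1 - t) * sqn (z - w) <= t * sqn z + (1 - t) * sqn w.
Proof.
rewrite -subr_ge0 /sqn !ReD !ImD !ReN !ImN.
set a := complex.Re z; set b := complex.Im z.
set c := complex.Re w; set d := complex.Im w.
have -> : t * (a ^+ 2 + b ^+ 2) + (1 - t) * (c ^+ 2 + d ^+ 2) -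
  t * (1 - t) * ((a - c) ^+ 2 + (b - d) ^+ 2) =
  (t * a + (1 - t) * c) ^+ 2 + (t * b + (1 - t) * d) ^+ 2 by ring.
by rewrite addr_ge0 ?sqr_ge0.
Qed.

(** The difference is the squared modulus of sqrt a z - i sqrt (1 - a) conj w. This is how squared
    off-diagonal entries absorb the commutator. *)
Lemma Im_mul_le (a : R) z w : 0 <= a -> a <= 1 ->
  2 * Num.sqrt (a * (1 - a)) * complex.Im (z * w) <= a * sqn z + (1 - a) * sqn w.
Proof.
move=> a0 a1; have b0 : 0 <= 1 - a by lra.
rewrite sqrtrM// ImM /sqn -subr_ge0.
set x := Num.sqrt a; set y := Num.sqrt (1 - a).
have {1}-> : a = x ^+ 2 by rewrite sqr_sqrtr.
have -> : 1 - a = y ^+ 2 by rewrite sqr_sqrtr.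
set p := complex.Re z; set q := complex.Im z.
set u := complex.Re w; set v := complex.Im w.
have -> : x ^+ 2 * (p ^+ 2 + q ^+ 2) + y ^+ 2 * (u ^+ 2 + v ^+ 2) -
   2 * (x * y) * (p * v + q * u) =
  (x * p - y * v) ^+ 2 + (x * q - y * u) ^+ 2 by ring.
by rewrite addr_ge0 ?sqr_ge0.
Qed.

Variable d : nat.
Implicit Types (W U V A B : 'M[R[i]]_d) (f : nat -> R).

Definition rdiag f : 'M[R[i]]_d := diag_mx (\row_(i < d) (f i)%:C).
(** For unitary W, the Hermitian matrix with eigenvalues f whose eigenvectors are the columns of
    W. *)
Definition ham W f := W *m rdiag f *m W^t*.

Lemma hamE W f j k :
  ham W f j k = \sum_(m < d) (f m)%:C * (W j m * Num.conj (W k m)).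
Proof.
rewrite /ham /rdiag mul_mx_diag mxE; apply: eq_bigr => m _.
by rewrite !mxE mulrAC mulrC mulrA.
Qed.

Lemma ham_conj W f j k : ham W f k j = Num.conj (ham W f j k).
Proof.
rewrite !hamE rmorph_sum; apply: eq_bigr => m _ /=.
by rewrite !rmorphM /= conj_real conjCK; congr (_ * _); rewrite mulrC.
Qed.

Lemma ham_diagE W f j : ham W f j j = (\sum_(m < d) f m * sqn (W j m))%:C.
Proof.
rewrite hamE rmorph_sum; apply: eq_bigr => m _ /=.
by rewrite mulCJ -rmorphM.
Qed.

Lemma unitaryCmx W : W \is unitarymx -> W^t* *m W = 1%:M.
Proof. by rewrite -trmxC_unitary => /unitarymxP; rewrite trmxCK. Qed.

Lemma ham_mul W f (h : nat -> R) : W \is unitarymx ->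
  ham W f *m ham W h = ham W (fun i => f i * h i).
Proof.
move=> Wu; rewrite /ham !mulmxA -(mulmxA _ (W^t*) W) unitaryCmx// mulmx1.
congr (_ *m _); rewrite -mulmxA; congr (_ *m _).
rewrite /rdiag mulmx_diag; congr diag_mx; apply/rowP => i; rewrite !mxE.
by rewrite -rmorphM.
Qed.

(** Both sides are the j-th diagonal entry of the square of [ham W f]. *)
Lemma sum_sqn_ham W f j : W \is unitarymx ->
  \sum_(k < d) sqn (ham W f j k) = \sum_(m < d) f m ^+ 2 * sqn (W j m).
Proof.
move=> Wu; apply: complexI; rewrite -(ham_diagE W (fun m => f m ^+ 2)).
rewrite (_ : ham W _ j j = (ham W f *m ham W f) j j); last by rewrite ham_mul.
rewrite mxE rmorph_sum; apply: eq_bigr => k _ /=.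
by rewrite (ham_conj W f j k) mulCJ.
Qed.

Lemma sum_sqn_row W j : W \is unitarymx -> \sum_(m < d) sqn (W j m) = 1.
Proof.
move=> /unitarymxP /matrixP/(_ j j); rewrite !mxE eqxx => H.
apply: complexI; rewrite rmorph_sum /= -[RHS]H; apply: eq_bigr => m _.
by rewrite !mxE mulCJ.
Qed.

Lemma sum_sqn_col W m : W \is unitarymx -> \sum_(j < d) sqn (W j m) = 1.
Proof.
rewrite -trmxC_unitary => /(@sum_sqn_row _ m) <-; apply: eq_bigr => j _.
by rewrite !mxE sqn_conj.
Qed.

Lemma hamB W f (h : nat -> R) j k :
  ham W f j k - ham W h j k = ham W (fun m => f m - h m) j k.
Proof.
rewrite !hamE -sumrB; apply: eq_bigr => m _.
by rewrite -mulrBl rmorphB.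
Qed.

Lemma ham_cst W (t : R) j k : W \is unitarymx -> j != k -> ham W (fun=> t) j k = 0.
Proof.
move=> /unitarymxP /matrixP/(_ j k) H /negbTE jk; rewrite !mxE jk in H.
rewrite hamE -mulr_sumr (_ : \sum_(m < d) _ = false%:R) ?mulr0// -H.
by apply: eq_bigr => m _; rewrite !mxE.
Qed.

Lemma ler_subD2 (s v w x y : R) : w <= x + y -> s + v - x - y + w <= s + v.
Proof. by move=> h; lra. Qed.

(** Division by t (1 - t) settles the interior; the last two hypotheses cover the endpoints. *)
Lemma le_of_convex_bounds (t u v w X Y : R) : 0 <= t -> t <= 1 ->
  u <= (1 - t) * X -> v <= t * Y -> t * (1 - t) * w <= t * u + (1 - t) * v ->
  0 <= X -> 0 <= Y -> (t = 0 -> w = u) -> (t = 1 -> w = v) -> w <= X + Y.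
Proof.
move=> t0 t1 hu hv hw X0 Y0 w0 w1.
have [t00|t00] := eqVneq t 0; first by move: hu; rewrite (w0 t00) t00; lra.
have [t11|t11] := eqVneq t 1; first by move: hv; rewrite (w1 t11) t11; lra.
have tp : 0 < t by rewrite lt_def t00.
have tq : 0 < 1 - t by rewrite subr_gt0 lt_def eq_sym t11.
rewrite -(ler_pM2l (mulr_gt0 tp tq)).
have h1 : t * u <= t * ((1 - t) * X) by rewrite ler_pM2l.
have h2 : (1 - t) * v <= (1 - t) * (t * Y) by rewrite ler_pM2l.
lra.
Qed.

(* A Ky Fan inequality with remainder: with alpha = (f - t)^+ and
   beta = (t - f)^+ the off-diagonal block is x - y, the squared norms of x and
   y being bounded by (1 - t) X and t Y, where X and Y are the traces missed by
   the threshold. *)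
Lemma ky_fan_threshold W f k (t : R) : W \is unitarymx -> 0 <= t -> t <= 1 ->
  (forall m, (m < d)%N -> 0 <= f m) -> (forall m, (m < d)%N -> f m <= 1) ->
  \sum_(j < d | (j < k)%N) \sum_(m < d) f m * sqn (W j m)
  + \sum_(j < d | (j < k)%N) \sum_(l < d | ~~ (l < k)%N) sqn (ham W f j l)
  <= \sum_(j < d | (j < k)%N) t + \sum_(m < d) Num.max (f m - t) 0.
Proof.
move=> Wu t0 t1 f0 f1.
pose al m := Num.max (f m - t) 0; pose be m := Num.max (t - f m) 0.
have al0 m : 0 <= al m by rewrite le_max lexx orbT.
have be0 m : 0 <= be m by rewrite le_max lexx orbT.
have ab m : f m = t + (al m - be m).
  rewrite /al /be; have [h|h] := leP (f m) t.
    by rewrite max_r ?max_l; lra.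
  by rewrite max_l ?max_r; lra.
pose X := \sum_(l < d | ~~ (l < k)%N) \sum_(m < d) al m * sqn (W l m).
pose Y := \sum_(l < d | (l < k)%N) \sum_(m < d) be m * sqn (W l m).
have X0 : 0 <= X by do 2 (apply: sumr_ge0 => ? _); rewrite mulr_ge0 ?sqn_ge0.
have Y0 : 0 <= Y by do 2 (apply: sumr_ge0 => ? _); rewrite mulr_ge0 ?sqn_ge0.
have sal : \sum_(l < d) \sum_(m < d) al m * sqn (W l m) = \sum_(m < d) al m.
  rewrite exchange_big; apply: eq_bigr => m _.
  by rewrite -mulr_sumr sum_sqn_col// mulr1.
(* Unit rows produce the term in t; unit columns make the [al] part the sum of all positive parts
   less X. *)
have dg : \sum_(j < d | (j < k)%N) \sum_(m < d) f m * sqn (W j m) =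
    \sum_(j < d | (j < k)%N) t + \sum_(m < d) al m - X - Y.
  rewrite -sal [Z in _ + Z - _ - _](bigID (fun l : 'I_d => (l < k)%N)) /= -/X.
  rewrite addrA addrK /Y.
  rewrite -big_split /= -sumrB; apply: eq_bigr => j _.
  rewrite -[t in RHS]mulr1 -(@sum_sqn_row W j Wu) mulr_sumr -big_split /= -sumrB.
  by apply: eq_bigr => m _; rewrite {1}ab; ring.
(* The constant t gives a multiple of the identity, invisible off the diagonal. *)
have offE (j l : 'I_d) : (j < k)%N -> ~~ (l < k)%N ->
    ham W f j l = ham W al j l - ham W be j l.
  move=> jk lk; have jl : j != l by apply: contraNneq lk => <-.
  rewrite hamB -[RHS]add0r -(@ham_cst W t j l Wu jl).
  rewrite !hamE -big_split /=; apply: eq_bigr => m _.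
  by rewrite -mulrDl -rmorphD /= -ab.
pose offs h := \sum_(j < d | (j < k)%N) \sum_(l < d | ~~ (l < k)%N) sqn (ham W h j l).
(* By symmetry the block is summed along its rows beyond k; f <= 1 gives al^2 <= (1 - t) al. *)
have al1 : offs al <= (1 - t) * X.
  rewrite /offs exchange_big /= /X mulr_sumr; apply: ler_sum => l _.
  apply: (@le_trans _ _ (\sum_(j < d) sqn (ham W al l j))).
    rewrite [leRHS](bigID (fun j : 'I_d => (j < k)%N)) /=.
    rewrite (eq_bigr (fun j : 'I_d => sqn (ham W al l j))); last first.
      by move=> j _; rewrite ham_conj sqn_conj.
    by rewrite lerDl; apply: sumr_ge0 => ? _; exact: sqn_ge0.
  rewrite sum_sqn_ham// mulr_sumr; apply: ler_sum => m _.
  rewrite mulrA ler_wpM2r ?sqn_ge0// expr2 ler_wpM2r//.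
  by rewrite /al ge_max; have := f1 m (ltn_ord m); lra.
have be1 : offs be <= t * Y.
  rewrite /offs /Y mulr_sumr; apply: ler_sum => l _.
  apply: (@le_trans _ _ (\sum_(j < d) sqn (ham W be l j))).
    rewrite [leRHS](bigID (fun j : 'I_d => (j < k)%N)) /=.
    by rewrite lerDr; apply: sumr_ge0 => ? _; exact: sqn_ge0.
  rewrite sum_sqn_ham// mulr_sumr; apply: ler_sum => m _.
  rewrite mulrA ler_wpM2r ?sqn_ge0// expr2 ler_wpM2r//.
  by rewrite /be ge_max; have := f0 m (ltn_ord m); lra.
suff Hf : offs f <= X + Y.
  by rewrite dg; exact: ler_subD2.
have cvx : t * (1 - t) * offs f <= t * offs al + (1 - t) * offs be.
  rewrite /offs !mulr_sumr -big_split /=; apply: ler_sum => j jk.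
  rewrite !mulr_sumr -big_split /=; apply: ler_sum => l lk.
  by rewrite offE// sqn_convex.
apply: (le_of_convex_bounds t0 t1 al1 be1 cvx X0 Y0) => [t00|t11].
  apply: eq_bigr => j jk; apply: eq_bigr => l lk; rewrite offE//.
  rewrite (_ : ham W be j l = 0) ?subr0// hamE big1// => m _.
  by rewrite /be t00 sub0r max_r ?mul0r// oppr_le0 f0.
apply: eq_bigr => j jk; apply: eq_bigr => l lk; rewrite offE//.
rewrite (_ : ham W al j l = 0) ?sub0r ?sqnN// hamE big1// => m _.
by rewrite /al t11 max_r ?mul0r// subr_le0 f1.
Qed.

End Compression.

(** * Spectral decomposition and the partial swap channel *)

Section Sorting.
Variable R : realType.

Lemma sorting_perm d (f : 'I_d -> R) :
  exists s : {perm 'I_d}, forall i j : 'I_d, (i <= j)%N -> f (s j) <= f (s i).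
Proof.
case: d f => [|d] f; first by exists 1%g => -[].
pose e := sort (fun i j : 'I_d.+1 => f j <= f i) (enum 'I_d.+1).
have es : size e = d.+1 by rewrite size_sort size_enum_ord.
have eu : uniq e by rewrite sort_uniq enum_uniq.
pose F (i : 'I_d.+1) := nth ord0 e i.
have Finj : injective F.
  by move=> i j /eqP; rewrite nth_uniq ?es// => /eqP/val_inj.
exists (perm Finj) => i j ij; rewrite !permE /F.
have tr : transitive (fun i j : 'I_d.+1 => f j <= f i).
  by move=> y x z xy yz; exact: le_trans yz xy.
have st : sorted (fun i j : 'I_d.+1 => f j <= f i) e.
  by apply: sort_sorted => x y; exact: le_total.
by apply: (sorted_leq_nth tr _ ord0 st) => //; rewrite ?inE ?es.
Qed.

End Sorting.

Section PartialSwap.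
Local Open Scope complex_scope.
Local Open Scope sesquilinear_scope.
Variables (R : realType) (d : nat).
Implicit Types (W U V A B : 'M[R[i]]_d) (f p : nat -> R).

Lemma hermsymP A : reflect (forall i j, A j i = Num.conj (A i j)) (A \is hermsymmx).
Proof.
apply: (iffP (is_hermitianmxP _ _ _)) => [H i j|H].
  by have /matrixP/(_ j i) := H; rewrite expr0 scale1r !mxE.
by apply/matrixP => i j; rewrite expr0 scale1r !mxE H.
Qed.

Lemma ham_hermsym W f : ham W f \is hermsymmx.
Proof. by apply/hermsymP => i j; exact: ham_conj. Qed.

Lemma spectral_decomp A : A \is hermsymmx ->
  A = (spectralmx A)^t* *m diag_mx (\row_i (complex.Re (spectral_diag A 0 i))%:C)
        *m spectralmx A.
Proof.
move=> Ah.
have E : \row_i (complex.Re (spectral_diag A 0 i))%:C = spectral_diag A.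
  apply/rowP => i; rewrite mxE; apply: RRe_real.
  by have /mxOverP := hermitian_spectral_diag_real Ah; apply.
rewrite E -(invmx_unitary (spectral_unitarymx A)).
exact/orthomx_spectralP/hermitian_normalmx.
Qed.

Lemma entropy_spectral A : A \is hermsymmx ->
  entropy A = \sum_(i < d) eta (complex.Re (spectral_diag A 0 i)).
Proof.
move=> Ah; rewrite /entropy /logmx; set V := spectralmx A.
have Vu : V \is unitarymx by exact: spectral_unitarymx.
rewrite {1}(spectral_decomp Ah) -/V (invmx_unitary Vu).
rewrite -!mulmxA (mulmxA V (V^t*)) (unitarymxP Vu) mul1mx.
rewrite mxtrace_mulC -!mulmxA (unitarymxP Vu) mulmx1 mulmx_diag mxtrace_diag.
rewrite Re_sum -sumrN; apply: eq_bigr => i _.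
by rewrite !mxE -rmorphM.
Qed.

(* If diag p = W diag q W^* then p_i = q_j wherever W_ij <> 0, so the doubly
   stochastic matrix |W_ij|^2 transports eta q to eta p. *)
Lemma entropy_ham U p : U \is unitarymx -> entropy (ham U p) = ent d p.
Proof.
move=> Uu; rewrite entropy_spectral ?ham_hermsym//.
set A := ham U p; set V := spectralmx A.
have Vu : V \is unitarymx by exact: spectral_unitarymx.
pose q i := complex.Re (spectral_diag A 0 i).
have AE := spectral_decomp (ham_hermsym U p).
rewrite -/A -/V in AE.
pose W := U^t* *m V^t*.
have Uc : U^t* \is unitarymx := etrans (trmxC_unitary U) Uu.
have Vc : V^t* \is unitarymx := etrans (trmxC_unitary V) Vu.
have Wu : W \is unitarymx := mul_unitarymx Uc Vc.
have WE : rdiag d p *m W = W *m diag_mx (\row_i (q i)%:C).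
  have AV : A *m V^t* = V^t* *m diag_mx (\row_i (q i)%:C).
    by rewrite AE -!mulmxA (unitarymxP Vu) mulmx1.
  by rewrite -mulmxA -AV /A /ham !mulmxA (unitaryCmx Uu) mul1mx.
move: W Wu WE => W Wu WE.
have E i j : sqn (W i j) * eta (p i) = sqn (W i j) * eta (q j).
  have /matrixP/(_ i j) := WE; rewrite /rdiag mul_diag_mx mul_mx_diag !mxE => H.
  have [W0|W0] := eqVneq (W i j) 0; first by rewrite W0 /sqn /= expr0n addr0 !mul0r.
  congr (_ * eta _); apply: (@complexI R); apply: (mulIf W0).
  by rewrite H mulrC.
rewrite /ent -/(q _); transitivity (\sum_(j < d) \sum_(i < d) sqn (W i j) * eta (q j)).
  apply: eq_bigr => j _; rewrite -mulr_suml sum_sqn_col// mul1r//.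
rewrite exchange_big /=; apply: eq_bigr => i _.
under eq_bigr do rewrite -E.
by rewrite -mulr_suml sum_sqn_row// mul1r.
Qed.

Lemma hermsym_ham A : A \is hermsymmx ->
  exists2 U, U \is unitarymx & exists2 p, descending d p & A = ham U p.
Proof.
move=> Ah; set V := spectralmx A.
have Vu : V \is unitarymx by exact: spectral_unitarymx.
pose q i := complex.Re (spectral_diag A 0 i).
have AE := spectral_decomp Ah; rewrite -/V in AE.
have [s sq] := sorting_perm q.
pose p n := if insub n is Some i then q (s i) else 0.
have pE (i : 'I_d) : p i = q (s i) by rewrite /p valK.
(* Row s j of V is the adjoint of an eigenvector; conjugated, it becomes column j of U. *)
pose U : 'M[R[i]]_d := \matrix_(i, j) Num.conj (V (s j) i).
have Uu : U \is unitarymx.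
  rewrite -trmxC_unitary; apply/unitarymxP/matrixP => i j.
  have /unitarymxP/matrixP/(_ (s i) (s j)) := Vu.
  rewrite !mxE (inj_eq perm_inj) => <-; apply: eq_bigr => k _.
  by rewrite !mxE !conjCK.
exists U => //; exists p.
  move=> i j ij jd; have id := leq_ltn_trans ij jd.
  by have := sq (Ordinal id) (Ordinal jd) ij; rewrite -!pE.
apply/matrixP => i j; rewrite hamE {1}AE mul_mx_diag mxE.
rewrite (reindex_inj (@perm_inj _ s)) /=; apply: eq_bigr => m _.
rewrite !mxE conjCK pE -/(q _); ring.
Qed.

Lemma mxtrace_ham U p : U \is unitarymx -> \tr (ham U p) = (\sum_(i < d) p i)%:C.
Proof.
move=> Uu; rewrite /ham mxtrace_mulC mulmxA unitaryCmx// mul1mx mxtrace_diag.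
by rewrite rmorph_sum; apply: eq_bigr => i _; rewrite mxE.
Qed.

Lemma density_ham U p : U \is unitarymx -> prob d p -> density R d (ham U p).
Proof.
move=> Uu [p0 p1]; split; last by rewrite mxtrace_ham// p1.
split; first exact: ham_hermsym.
move=> v; pose w := U^t* *m v.
have -> : v^t* *m ham U p *m v = w^t* *m rdiag d p *m w.
  by rewrite /w /ham trmx_mul map_mxM trmxCK !mulmxA.
rewrite mul_mx_diag mxE; apply: sumr_ge0 => i _; rewrite !mxE.
rewrite mulrAC -[Num.conj _ * _]mulrC; apply: mulr_ge0; last by rewrite ler0c p0.
by rewrite mulCJ ler0c sqn_ge0.
Qed.

Lemma density_hamP A : density R d A ->
  exists2 U, U \is unitarymx & exists2 p, descending d p /\ prob d p & A = ham U p.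
Proof.
move=> [[Ah A0] tr1]; have [U Uu [p sp AE]] := hermsym_ham Ah.
exists U => //; exists p => //; split=> //; split; last first.
  by apply: complexI; rewrite -(mxtrace_ham p Uu) -AE tr1.
(* Tested on its i-th eigenvector, the quadratic form returns p_i. *)
move=> i di; have := A0 (U *m delta_mx (Ordinal di) 0).
rewrite AE /ham trmx_mul map_mxM !mulmxA.
rewrite -(mulmxA _ (U^t*) U) unitaryCmx// mulmx1.
rewrite -(mulmxA _ (U^t*) U) unitaryCmx// mulmx1.
rewrite mul_mx_diag mxE (bigD1 (Ordinal di))//= big1 ?addr0.
  by rewrite !mxE !eqxx /= conjC1 mul1r mulr1 ler0c.
by move=> j /negbTE ji; rewrite !mxE ji mulr0.
Qed.

(** * The channel in an eigenbasis of its output *)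

Lemma hermsym_qadd a A B : A \is hermsymmx -> B \is hermsymmx ->
  qadd a B A \is hermsymmx.
Proof.
move=> /hermsymP Ah /hermsymP Bh; apply/hermsymP => i j.
rewrite /qadd /commutator !mxE !(rmorphB, rmorphD, rmorphM, rmorph_sum) /=.
rewrite !conj_real Ah Bh; congr (_ - _).
(* The factor i and the commutator both change sign under the adjoint. *)
have -> : Num.conj 'i%C = - 'i%C :> R[i] by apply: eq_ReIm; rewrite /= ?oppr0.
rewrite mulrN mulNr -mulrN opprB; congr (_ * (_ - _)); apply: eq_bigr => k _;
  by rewrite rmorphM /= -Ah -Bh mulrC.
Qed.

Lemma qadd_conj a U A B : U \is unitarymx ->
  U^t* *m qadd a B A *m U = qadd a (U^t* *m B *m U) (U^t* *m A *m U).
Proof.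
move=> Uu; have UU := unitarymxP Uu.
have mm X Y : U^t* *m X *m U *m (U^t* *m Y *m U) = U^t* *m (X *m Y) *m U.
  by rewrite !mulmxA -(mulmxA _ U (U^t*)) UU mulmx1.
rewrite /qadd /commutator !mm mulmxBr mulmxBl mulmxDr mulmxDl.
by rewrite -!scalemxAr -!scalemxAl mulmxBr mulmxBl.
Qed.

Lemma mxtrace_qadd a A B : \tr A = 1 -> \tr B = 1 -> \tr (qadd a B A) = 1.
Proof.
move=> A1 B1; have trB (X Y : 'M[R[i]]_d) : \tr (X - Y) = \tr X - \tr Y.
  by rewrite mxtraceD -scaleN1r mxtraceZ mulN1r.
rewrite /qadd /commutator trB mxtraceD !mxtraceZ trB A1 B1 [\tr (B *m A)]mxtrace_mulC.
by rewrite subrr mulr0 subr0 !mulr1 -rmorphD /= addrC subrK.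
Qed.

(** With z = (A B)_jj, the commutator has diagonal entry z - conj z = 2 i Im z. *)
Lemma qadd_diag_Re a A B j : A \is hermsymmx -> B \is hermsymmx ->
  complex.Re (qadd a B A j j) = a * complex.Re (A j j) + (1 - a) * complex.Re (B j j)
   + 2 * Num.sqrt (a * (1 - a)) * \sum_(l < d) complex.Im (A j l * B l j).
Proof.
move=> /hermsymP Ah /hermsymP Bh; rewrite /qadd /commutator !mxE.
have -> : \sum_(l < d) B j l * A l j = Num.conj (\sum_(l < d) A j l * B l j).
  rewrite rmorph_sum; apply: eq_bigr => l _.
  by rewrite rmorphM /= -Ah -Bh mulrC.
rewrite -Im_sum; set z := \sum_(l < d) A j l * B l j.
by rewrite !(ReD, ReN, ReM, ImD, ImN, ImM, Re_conj, Im_conj) /=; ring.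
Qed.

(** Exchanging j and l conjugates each term, so the sum is its own negative. *)
Lemma sum_prefix_Im_eq0 k A B : A \is hermsymmx -> B \is hermsymmx ->
  \sum_(j < d | (j < k)%N) \sum_(l < d | (l < k)%N) complex.Im (A j l * B l j) = 0.
Proof.
move=> /hermsymP Ah /hermsymP Bh.
set S := LHS; suff : S = - S by lra.
rewrite {1}/S exchange_big /= -sumrN; apply: eq_bigr => j _.
rewrite -sumrN; apply: eq_bigr => l _.
by rewrite (Ah j l) (Bh l j) -rmorphM Im_conj.
Qed.

(** [ky_fan_threshold] with t the k-th largest eigenvalue: only the first k entries have positive
    part f_m - t, which restores their sum. *)
Lemma ky_fan_prefix W f k : W \is unitarymx -> prob d f -> descending d f ->
  (k <= d)%N ->
  \sum_(j < d | (j < k)%N) complex.Re (ham W f j j)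
  + \sum_(j < d | (j < k)%N) \sum_(l < d | ~~ (l < k)%N) sqn (ham W f j l)
  <= \sum_(j < k) f j.
Proof.
move=> Wu pf sf kd; case: k kd => [|k] kd; first by rewrite big_ord0 !big_pred0 ?addr0.
have [f0 _] := pf; have f1 := prob_le1 pf.
have := ky_fan_threshold k.+1 Wu (f0 k kd) (f1 k kd) f0 f1.
rewrite (eq_bigr (fun j : 'I_d => complex.Re (ham W f j j))); last first.
  by move=> j _; rewrite ham_diagE.
move=> H; apply: (le_trans H).
rewrite [Z in _ + Z](bigID (fun m : 'I_d => (m < k.+1)%N)) /=.
rewrite [Z in _ + (_ + Z)]big1 ?addr0; last first.
  move=> m; rewrite -leqNgt => km; rewrite max_r// subr_le0.
  by apply: sf => //; exact: ltnW.
rewrite -big_split /= [leRHS](big_ord_widen d f kd); apply: ler_sum => m mk.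
by rewrite max_l ?subr_ge0 ?sf// addrC subrK.
Qed.

Lemma qadd_prefix_le a W V f p k (A := ham W f) (B := ham V p) :
  0 <= a -> a <= 1 -> W \is unitarymx -> V \is unitarymx ->
  prob d f -> prob d p -> descending d f -> descending d p -> (k <= d)%N ->
  \sum_(j < d | (j < k)%N) complex.Re (qadd a B A j j) <= \sum_(j < k) mix a f p j.
Proof.
move=> a0 a1 Wu Vu pf pp sf sp kd.
have Ah : A \is hermsymmx by exact: ham_hermsym.
have Bh : B \is hermsymmx by exact: ham_hermsym.
have KA := ky_fan_prefix Wu pf sf kd; have KB := ky_fan_prefix Vu pp sp kd.
rewrite -/A in KA; rewrite -/B in KB.
move: A B Ah Bh KA KB => A B Ah Bh KA KB.
have -> : \sum_(j < k) mix a f p j = a * \sum_(j < k) f j + (1 - a) * \sum_(j < k) p j.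
  by rewrite !mulr_sumr -big_split.
(* Pairs inside the block cancel; [Im_mul_le] bounds the others by exactly the Ky Fan remainders of
   A and B. *)
have off : 2 * Num.sqrt (a * (1 - a)) *
      \sum_(j < d | (j < k)%N) \sum_(l < d) complex.Im (A j l * B l j)
   <= a * (\sum_(j < d | (j < k)%N) \sum_(l < d | ~~ (l < k)%N) sqn (A j l))
      + (1 - a) * (\sum_(j < d | (j < k)%N) \sum_(l < d | ~~ (l < k)%N) sqn (B j l)).
  under eq_bigr do rewrite (bigID (fun l : 'I_d => (l < k)%N)) /=.
  rewrite big_split /= (sum_prefix_Im_eq0 k Ah Bh) add0r !mulr_sumr -big_split /=.
  apply: ler_sum => j _; rewrite !mulr_sumr -big_split /=; apply: ler_sum => l _.
  have := Im_mul_le (A j l) (B l j) a0 a1.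
  by rewrite (elimT (hermsymP B) Bh j l) sqn_conj.
have -> : \sum_(j < d | (j < k)%N) complex.Re (qadd a B A j j) =
  a * (\sum_(j < d | (j < k)%N) complex.Re (A j j))
  + (1 - a) * (\sum_(j < d | (j < k)%N) complex.Re (B j j))
  + 2 * Num.sqrt (a * (1 - a)) *
      \sum_(j < d | (j < k)%N) \sum_(l < d) complex.Im (A j l * B l j).
  rewrite !mulr_sumr -!big_split /=; apply: eq_bigr => j _.
  exact: (qadd_diag_Re a j Ah Bh).
have hA := ler_wpM2l a0 KA.
have b0 : 0 <= 1 - a by rewrite subr_ge0.
have hB := ler_wpM2l b0 KB.
apply: le_trans (lerD hA hB); rewrite !(mulrDr _ (bigop _ _ _)) addrACA.
by rewrite lerD2l.
Qed.

Lemma ham_conj_unitary U W f : U^t* *m ham W f *m U = ham (U^t* *m W) f.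
Proof. by rewrite /ham trmx_mul map_mxM trmxCK !mulmxA. Qed.

Lemma qadd_majorized a rho sigma : 0 <= a -> a <= 1 ->
  density R d rho -> density R d sigma ->
  exists l m, [/\ [/\ prob d l, descending d l & entropy rho = ent d l],
    [/\ prob d m, descending d m & entropy sigma = ent d m],
    density R d (qadd a sigma rho) &
    ent d (mix a l m) <= entropy (qadd a sigma rho)].
Proof.
move=> a0 a1 rd sd.
have [W Wu [l [sl pl] rE]] := density_hamP rd.
have [V Vu [m [sm pm] sE]] := density_hamP sd.
have Th : qadd a sigma rho \is hermsymmx.
  by apply: hermsym_qadd; [case: rd => -[]|case: sd => -[]].
have [U Uu [p sp TE]] := hermsym_ham Th.
have pmix := prob_mix a0 a1 pl pm.
have Uc : U^t* \is unitarymx by rewrite trmxC_unitary.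
have UW := mul_unitarymx Uc Wu.
have UV := mul_unitarymx Uc Vu.
have dE (j : 'I_d) :
    complex.Re (qadd a (ham (U^t* *m V) m) (ham (U^t* *m W) l) j j) = p j.
  rewrite -!ham_conj_unitary -(qadd_conj _ _ _ Uu) -rE -sE TE /ham !mulmxA.
  by rewrite (unitaryCmx Uu) mul1mx -mulmxA (unitaryCmx Uu) mulmx1 !mxE eqxx.
have maj k : (k <= d)%N -> \sum_(j < k) p j <= \sum_(j < k) mix a l m j.
  move=> kd; apply: le_trans (qadd_prefix_le a0 a1 UW UV pl pm sl sm kd).
  by rewrite (big_ord_widen d p kd); under [leRHS]eq_bigr do rewrite dE.
have p1 : \sum_(j < d) p j = 1.
  apply: complexI; rewrite -(mxtrace_ham p Uu) -TE.
  by apply: mxtrace_qadd; [case: rd|case: sd].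
have pp : prob d p.
  (* Both vectors sum to 1 and p has no larger sum over the first n entries, so its smallest entry
     is at least that of the mixture. *)
  split=> // i di; case: d p1 maj di sp pmix => [//|n] p1 maj di sp [q0 q1].
  apply: le_trans (sp i n _ _) => //.
  have := maj n (leqnSn n); have := q0 n (ltnSn n).
  by move: p1 q1; rewrite !big_ord_recr /=; lra.
have eR : entropy rho = ent d l by rewrite rE (entropy_ham l Wu).
have eS : entropy sigma = ent d m by rewrite sE (entropy_ham m Vu).
exists l, m; split; [by split|by split| |].
  by rewrite TE; exact: (density_ham Uu pp).
by rewrite TE (entropy_ham p Uu); exact: (ent_le_of_majorized pp pmix sp maj).
Qed.

End PartialSwap.

(** * Existence of the minimum output entropy *)

Section ComplexContinuity.
Local Open Scope complex_scope.
Local Open Scope sesquilinear_scope.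
Variables (R : realType) (X : topologicalType).
Implicit Types F G : X -> R[i].

(** Phrased through real and imaginary parts, so that only the topology of R enters. *)
Definition ccontinuous F :=
  continuous (fun x => complex.Re (F x) : R) /\
  continuous (fun x => complex.Im (F x) : R).

Lemma ccontinuous_eq F G : (forall x, F x = G x) -> ccontinuous F -> ccontinuous G.
Proof. by move=> /funext ->. Qed.

Lemma ccontinuous_cst z : ccontinuous (fun=> z).
Proof. by split; exact: cst_continuous. Qed.

Lemma ccontinuous_real (f : X -> R) : continuous f -> ccontinuous (fun x => (f x)%:C).
Proof. by move=> fc; split => //=; exact: cst_continuous. Qed.

Lemma ccontinuousD F G : ccontinuous F -> ccontinuous G ->
  ccontinuous (fun x => F x + G x).
Proof.
move=> [Fr Fi] [Gr Gi]; split.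
  under eq_fun do rewrite ReD.
  by move=> x; apply: cvgD; [exact: Fr|exact: Gr].
under eq_fun do rewrite ImD.
by move=> x; apply: cvgD; [exact: Fi|exact: Gi].
Qed.

Lemma ccontinuousN F : ccontinuous F -> ccontinuous (fun x => - F x).
Proof.
move=> [Fr Fi]; split.
  under eq_fun do rewrite ReN.
  by move=> x; apply: cvgN; exact: Fr.
under eq_fun do rewrite ImN.
by move=> x; apply: cvgN; exact: Fi.
Qed.

Lemma ccontinuousM F G : ccontinuous F -> ccontinuous G ->
  ccontinuous (fun x => F x * G x).
Proof.
move=> [Fr Fi] [Gr Gi]; split.
  under eq_fun do rewrite ReM.
  by move=> x; apply: cvgB; apply: cvgM; [exact: Fr|exact: Gr|exact: Fi|exact: Gi].
under eq_fun do rewrite ImM.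
by move=> x; apply: cvgD; apply: cvgM; [exact: Fr|exact: Gi|exact: Fi|exact: Gr].
Qed.

Lemma ccontinuous_conj F : ccontinuous F -> ccontinuous (fun x => Num.conj (F x)).
Proof.
move=> [Fr Fi]; split.
  by under eq_fun do rewrite Re_conj.
under eq_fun do rewrite Im_conj.
by move=> x; apply: cvgN; exact: Fi.
Qed.

Lemma ccontinuous_sum (I : Type) (r : seq I) (F : I -> X -> R[i]) :
  (forall i, ccontinuous (F i)) -> ccontinuous (fun x => \sum_(i <- r) F i x).
Proof.
move=> Fc; elim: r => [|i r IH].
  by apply: ccontinuous_eq (ccontinuous_cst 0) => x; rewrite big_nil.
by apply: ccontinuous_eq (ccontinuousD (Fc i) IH) => x; rewrite big_cons.
Qed.

Lemma closed_eqR (f : X -> R) (c : R) : continuous f -> closed [set x | f x = c].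
Proof.
move=> fc; rewrite (_ : [set x | f x = c] = f @^-1` [set c])//.
by apply: preimage_closed => [x _|]; [exact: fc|exact: closed_eq].
Qed.

Lemma closed_ceq F G : ccontinuous F -> ccontinuous G -> closed [set x | F x = G x].
Proof.
move=> Fc Gc; have [Hr Hi] := ccontinuousD Fc (ccontinuousN Gc).
rewrite (_ : [set x | F x = G x] = [set x | complex.Re (F x + - G x) = 0] `&`
  [set x | complex.Im (F x + - G x) = 0]).
  by apply: closedI; exact: closed_eqR.
apply/seteqP; split => x /=; first by move=> E; split => /=; rewrite E subrr.
by move=> [h1 h2]; apply/eqP; rewrite -subr_eq0; apply/eqP; exact: eq_ReIm.
Qed.

Lemma closed_cmx_eq m n (F G : X -> 'M[R[i]]_(m, n)) :
  (forall i j, ccontinuous (fun x => F x i j)) ->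
  (forall i j, ccontinuous (fun x => G x i j)) -> closed [set x | F x = G x].
Proof.
move=> Fc Gc.
rewrite (_ : [set x | _] = \bigcap_(ij in [set: 'I_m * 'I_n])
   [set x | F x ij.1 ij.2 = G x ij.1 ij.2]).
  by apply: closed_bigI => ij _; exact: closed_ceq.
apply/seteqP; split => x /=; first by move=> E ij _ /=; rewrite E.
by move=> H; apply/matrixP => i j; exact: (H (i, j) I).
Qed.

Lemma ccontinuous_mulmx m n p (F : X -> 'M[R[i]]_(m, n)) (G : X -> 'M[R[i]]_(n, p)) :
  (forall i j, ccontinuous (fun x => F x i j)) ->
  (forall i j, ccontinuous (fun x => G x i j)) ->
  forall i j, ccontinuous (fun x => (F x *m G x) i j).
Proof.
move=> Fc Gc i j; under eq_fun do rewrite mxE.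
by apply: ccontinuous_sum => k; exact: ccontinuousM.
Qed.

Lemma ccontinuous_ham d (W : X -> 'M[R[i]]_d) (f : X -> nat -> R) :
  (forall i j, ccontinuous (fun x => W x i j)) -> (forall i, continuous (f^~ i)) ->
  forall i j, ccontinuous (fun x => ham (W x) (f x) i j).
Proof.
move=> Wc fc i j; under eq_fun do rewrite hamE.
apply: ccontinuous_sum => k; apply: ccontinuousM; first exact: ccontinuous_real.
by apply: ccontinuousM => //; exact: ccontinuous_conj.
Qed.

Lemma closed_unitary d (W : X -> 'M[R[i]]_d) :
  (forall i j, ccontinuous (fun x => W x i j)) -> closed [set x | W x \is unitarymx].
Proof.
move=> Wc; rewrite (_ : [set x | _] = [set x | W x *m (W x)^t* = 1%:M]).
  apply: closed_cmx_eq => i j; last exact: ccontinuous_cst.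
  apply: ccontinuous_mulmx => // k l; under eq_fun do rewrite !mxE.
  exact: ccontinuous_conj.
by apply/seteqP; split => x /= /unitarymxP.
Qed.

Lemma closed_prob d (f : X -> nat -> R) : (forall i, continuous (f^~ i)) ->
  closed [set x | prob d (f x)].
Proof.
move=> fc; rewrite (_ : [set x | _] =
  (\bigcap_(i in [set i | (i < d)%N]) [set x | 0 <= f x i]) `&`
   [set x | \sum_(i < d) f x i = 1]).
  apply: closedI.
    apply: closed_bigI => i _.
    rewrite (_ : [set x | _] = (f^~ i) @^-1` [set y | 0 <= y])//.
    by apply: preimage_closed => [x _|]; [exact: fc|exact: closed_ge].
  apply: closed_eqR; elim: d => [|k IH].
    by under eq_fun do rewrite big_ord0; exact: cst_continuous.
  under eq_fun do rewrite big_ord_recr/=.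
  by move=> x; apply: cvgD; [exact: IH|exact: fc].
by apply/seteqP; split => x.
Qed.

Lemma ccontinuous_qadd d a (sigma : 'M[R[i]]_d) (A : X -> 'M[R[i]]_d) :
  (forall i j, ccontinuous (fun x => A x i j)) ->
  forall i j, ccontinuous (fun x => qadd a sigma (A x) i j).
Proof.
move=> Ac i j; rewrite /qadd /commutator.
have c1 : ccontinuous (fun x => (A x *m sigma) i j).
  by apply: ccontinuous_mulmx => // k l; exact: ccontinuous_cst.
have c2 : ccontinuous (fun x => (sigma *m A x) i j).
  by apply: ccontinuous_mulmx => // k l; exact: ccontinuous_cst.
apply: ccontinuous_eq (ccontinuousD (ccontinuousD
  (ccontinuousM (ccontinuous_cst (a%:C)) (Ac i j))
  (ccontinuous_cst ((1 - a)%:C * sigma i j)))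
  (ccontinuousN (ccontinuousM (ccontinuous_cst ((Num.sqrt (a * (1 - a)))%:C * 'i%C))
    (ccontinuousD c1 (ccontinuousN c2))))) => x.
by rewrite ![in RHS]mxE; congr (_ - _ * (_ - _)); rewrite mxE.
Qed.

Lemma continuous_ent d (f : X -> nat -> R) : (forall i, continuous (f^~ i)) ->
  continuous (fun x => ent d (f x)).
Proof.
move=> fc; rewrite /ent; elim: d => [|k IH].
  by under eq_fun do rewrite big_ord0; exact: cst_continuous.
under eq_fun do rewrite big_ord_recr/=.
move=> x; apply: cvgD; first exact: IH.
exact: (continuous_comp (fc k x) (@eta_continuous R (f x k))).
Qed.

End ComplexContinuity.

(** * Attainment of the minimum by compactness *)

Section MinOutput.
Local Open Scope complex_scope.
Local Open Scope sesquilinear_scope.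
Variables (R : realType) (d : nat).

Lemma unitary_entry_bound (W : 'M[R[i]]_d) i j : W \is unitarymx ->
  `|complex.Re (W i j)| <= 1 /\ `|complex.Im (W i j)| <= 1.
Proof.
move=> Wu.
have : sqn (W i j) <= 1.
  rewrite -(sum_sqn_row i Wu) (bigD1 j)//= lerDl.
  by apply: sumr_ge0 => k _; exact: sqn_ge0.
rewrite /sqn => h; have := sqr_ge0 (complex.Re (W i j)).
have := sqr_ge0 (complex.Im (W i j)).
by move=> h1 h2; split; rewrite -(@expr_le1 R 2%N) ?normr_ge0// real_normK
  ?num_real//; lra.
Qed.

Notation coords := (prod_topology (fun _ : nat * nat * nat => (R : topologicalType))).

(* A point of [coords] encodes in the slots [c], [c + 1], [c + 2] the real and
   imaginary parts of a matrix and a list of eigenvalues. *)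
Definition cmx c (x : coords) : 'M[R[i]]_d :=
  \matrix_(i, j) (Complex (x (c, nat_of_ord i, nat_of_ord j))
    (x (c.+1, nat_of_ord i, nat_of_ord j))).
Definition ceig c (x : coords) (i : nat) : R := x (c.+2, i, 0%N).

Lemma coord_continuous k : continuous (fun x : coords => x k : R).
Proof.
exact: (@proj_continuous _ (fun _ : nat * nat * nat => (R : topologicalType)) k).
Qed.

Lemma ccontinuous_cmx c i j : ccontinuous (fun x => cmx c x i j).
Proof.
apply: (@ccontinuous_eq _ _ (fun x : coords => Complex (x (c, nat_of_ord i, nat_of_ord j))
  (x (c.+1, nat_of_ord i, nat_of_ord j)))).
  by move=> x; rewrite mxE.
by split; exact: coord_continuous.
Qed.

(** Eigenvectors and spectra of input and output become coordinates in a closed part of a cube,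
    compact by Tychonoff's theorem, on which the output entropy is continuous. *)
Lemma min_output_entropy_exists a (sigma : 'M[R[i]]_d) : (0 < d)%N ->
  (forall rho, density R d rho -> density R d (qadd a sigma rho)) ->
  exists Hmin, is_min_output_entropy (qadd a sigma) Hmin.
Proof.
move=> d0 hE.
(* Slots 0 to 2 hold the output, slots 3 to 5 the input. *)
pose K := [set x : coords | forall k, x k \in `[-1, 1]] `&`
  ([set x | cmx 0 x \is unitarymx] `&` [set x | prob d (ceig 0 x)] `&`
   [set x | cmx 3 x \is unitarymx] `&` [set x | prob d (ceig 3 x)] `&`
   [set x | ham (cmx 0 x) (ceig 0 x) = qadd a sigma (ham (cmx 3 x) (ceig 3 x))]).
have cK : compact K.
  apply: compact_closedI.
    apply: (@tychonoff _ (fun _ : nat * nat * nat => (R : topologicalType))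
      (fun _ => [set y | y \in `[-1, 1]])) => k.
    exact: segment_compact.
  have cc c i j := @ccontinuous_cmx c i j.
  have ce c i : continuous ((ceig c)^~ i) by exact: coord_continuous.
  have ch c := ccontinuous_ham (cc c) (ce c).
  apply: closedI; last by apply: closed_cmx_eq => //; exact: ccontinuous_qadd.
  apply: closedI; last exact: closed_prob.
  apply: closedI; last exact: closed_unitary.
  by apply: closedI; [exact: closed_unitary|exact: closed_prob].
have enc rho : density R d rho -> exists x, [/\ K x,
    rho = ham (cmx 3 x) (ceig 3 x) & entropy (qadd a sigma rho) = ent d (ceig 0 x)].
  move=> rd; have [W Wu [p [_ pp] rE]] := density_hamP rd.
  have [U Uu [q [_ qp] sE]] := density_hamP (hE _ rd).
  (* Indices outside the matrix get the value 0, which stays in the cube. *)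
  pose mat (M : 'M[R[i]]_d) (re : bool) i j : R :=
    if insub i is Some i' then if insub j is Some j' then
      if re then complex.Re (M i' j') else complex.Im (M i' j') else 0 else 0.
  pose vec (f : nat -> R) i : R := if (i < d)%N then f i else 0.
  pose x : coords := fun k => let: (c, i, j) := k in
    match c with
    | 0 => mat U true i j | 1 => mat U false i j | 2 => vec q i
    | 3 => mat W true i j | 4 => mat W false i j | 5 => vec p i | _ => 0%R end%N.
  have x0 : cmx 0 x = U.
    by apply/matrixP => i j; rewrite mxE /x /mat !valK; case: (U i j).
  have x3 : cmx 3 x = W.
    by apply/matrixP => i j; rewrite mxE /x /mat !valK; case: (W i j).
  have hv V (f g : nat -> R) : (forall i, (i < d)%N -> f i = g i) ->
      ham V f = ham V g :> 'M[R[i]]_d.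
    move=> fg; apply/matrixP => i j; rewrite !hamE.
    by apply: eq_bigr => m _; rewrite fg.
  have v0 i : (i < d)%N -> ceig 0 x i = q i by move=> id; rewrite /ceig /x /vec id.
  have v3 i : (i < d)%N -> ceig 3 x i = p i by move=> id; rewrite /ceig /x /vec id.
  have pr (f g : nat -> R) : (forall i, (i < d)%N -> f i = g i) -> prob d g -> prob d f.
    move=> fg [g0 g1]; split=> [i id|]; first by rewrite fg// g0.
    by rewrite -g1; apply: eq_bigr => i _; rewrite fg.
  exists x; split.
  - split.
      have bm M re i j : M \is unitarymx -> mat M re i j \in `[-1, 1].
        move=> Mu; rewrite in_itv/= -ler_norml /mat.
        case: insubP => [i' _ _|_]; last by rewrite normr0.
        case: insubP => [j' _ _|_]; last by rewrite normr0.
        by case: re; have [] := unitary_entry_bound i' j' Mu.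
      have bv f i : prob d f -> vec f i \in `[-1, 1].
        move=> pf; have [f0 _] := pf; rewrite in_itv/= -ler_norml /vec.
        case: ifP => [id|_]; last by rewrite normr0.
        by rewrite ger0_norm ?f0// (prob_le1 pf).
      move=> [[c i] j] /=; case: c => [|[|[|[|[|[|c]]]]]] /=;
        try exact: bm; try exact: bv.
      by rewrite in_itv/= lerN10 ler01.
    rewrite /= x0 x3 (hv U _ q v0) (hv W _ p v3) -rE -sE.
    exact (conj (conj (conj (conj Uu (pr _ _ v0 qp)) Wu) (pr _ _ v3 pp)) erefl).
  - by rewrite x3 (hv W _ p v3).
  - rewrite sE (entropy_ham q Uu); apply: eq_bigr => i _.
    by rewrite v0.
have K0 : K !=set0.
  pose e (i : nat) : R := (i == 0%N)%:R.
  have pe : prob d e.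
    split=> [i _|]; first by rewrite ler0n.
    rewrite (bigD1 (Ordinal d0))//= big1 ?addr0// => i; rewrite /e -val_eqE /=.
    by move=> /negbTE ->.
  have u1 : (1%:M : 'M[R[i]]_d) \is unitarymx.
    by apply/unitarymxP; rewrite mul1mx trmx1 map_mx1.
  by have [x [Kx _ _]] := enc _ (density_ham u1 pe); exists x.
have fc : {within K, continuous (fun x => ent d (ceig 0 x))}.
  by apply: continuous_subspaceT; apply: continuous_ent => i; exact: coord_continuous.
have [x xK xmin] := compact_EVT_min K0 cK fc.
exists (ent d (ceig 0 x)); split.
  have [_ [[[[u0 p0] u3] p3] E]] := set_mem xK.
  exists (ham (cmx 3 x) (ceig 3 x)); first exact: (density_ham u3 p3).
  by rewrite -E (entropy_ham _ u0).
move=> _ [rho rd <-]; have [y [Ky _ ->]] := enc _ rd.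
by apply: xmin; exact: mem_set.
Qed.

End MinOutput.

Theorem mainTheorem5 (R : realType) (d : nat) (hd : (2 <= d)%N)
    (a : R) (ha0 : 0 <= a) (ha1 : a <= 1)
    (sigma : 'M[R[i]]_d) (hsigma : density R d sigma) :
  exists2 Hmin : R,
    is_min_output_entropy (qadd a sigma) Hmin &
    forall G : R -> R,
      [\/ G = G_lin a (entropy sigma),
          G = G_exp ((ln d%:R ^+ 2)^-1) a (entropy sigma)
        | G = G_g ((d%:R - 1)^-1) a (entropy sigma)] ->
      (exists2 Gmin : R,
         is_min [set G H0 | H0 in `[0, ln d%:R]] Gmin & Gmin <= Hmin) /\
      (forall rho : 'M[R[i]]_d, density R d rho ->
         G (entropy rho) <= entropy (qadd a sigma rho)).
Proof.
have d0 : (0 < d)%N by exact: ltnW.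
have d1 : 0 <= d%:R - 1 :> R by rewrite subr_ge0 ler1n.
have hE rho : density R d rho -> density R d (qadd a sigma rho).
  by move=> rd; have [l [m []]] := qadd_majorized ha0 ha1 rd hsigma.
have ent0 rho : density R d rho -> 0 <= entropy rho.
  move=> rd; have [l [m [[pl _ ->] _ _ _]]] := qadd_majorized ha0 ha1 rd hsigma.
  exact: ent_ge0.
have [Hmin HminP] := min_output_entropy_exists d0 hE.
exists Hmin; first exact HminP.
move=> G GE.
have GH rho : density R d rho -> G (entropy rho) <= entropy (qadd a sigma rho).
  move=> rd.
  have [l [m [[pl sl ->] [pm sm sE] _]]] := qadd_majorized ha0 ha1 rd hsigma.
  apply: le_trans; case: GE => ->; rewrite sE.
  - exact: G_lin_ent_mix.
  - exact: G_exp_ent_mix.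
  - exact: G_g_ent_mix.
have Gmono H0 : 0 <= H0 -> G 0 <= G H0.
  move=> h0; case: GE => ->.
  - exact: le_G_lin_0.
  - by apply: le_G_exp_0; rewrite // invr_ge0 sqr_ge0.
  - by apply: le_G_g_0; rewrite ?invr_ge0 ?ent0.
split=> //; exists (G 0).
  split; first by exists 0 => //=; rewrite in_itv/= lexx ln_ge0// ler1n.
  by move=> _ [H0 /= + <-]; rewrite in_itv/= => /andP[/Gmono].
(* At a minimizer rho, G 0 <= G (H (rho)) <= Hmin. *)
have [[rho rd <-] _] := HminP.
exact: le_trans (Gmono _ (ent0 _ rd)) (GH _ rd).
Qed.
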